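(* Let $\mathbf{X}$ be a computably discrete represented space. The following are equivalent: (1) $\mathbf{X}$ admits a computably equivalent representation with domain $\mathbb{N}^{\mathbb{N}}$, i.e. there is a total surjection $\delta':\mathbb{N}^{\mathbb{N}}\to X$ such that the identity map is computable both from $(X,\delta')$ to $\mathbf{X}$ and from $\mathbf{X}$ to $(X,\delta')$. (2) There exists a computable surjection $s:\mathbb{N}\to\mathbf{X}$. (3) $\mathbf{X}$ is computably Quasi-Polish. (4) $\mathbf{X}$ is computably isomorphic to a computably discrete quotient $\mathbb{N}/R$ of $\mathbb{N}$ by some equivalence relation $R$. (5) $\mathbf{X}$ is computably isomorphic to a computably admissible quotient $\mathbb{N}/R$ of $\mathbb{N}$ by some equivalence relation $R$.
   Context: A represented space $\mathbf{X}=(X,\delta_{\mathbf{X}})$ is a set $X$ with a partial surjection $\delta_{\mathbf{X}}:\subseteq\mathbb{N}^{\mathbb{N}}\to X$; any $p$ with $\delta_{\mathbf X}(p)=x$ is a name of $x$. A realiser of a map $f:\mathbf{X}\to\mathbf{Y}$ is a partial map $R_f:\subseteq\mathbb{N}^{\mathbb{N}}\to\mathbb{N}^{\mathbb{N}}$ sending every name of every $x\in X$ to a name of $f(x)$; $f$ is computable (continuously realisable) if it has a computable (continuous) realiser. A computable isomorphism is a computable bijection with computable inverse. $\mathbb{N}$ is represented by $\delta_{\mathbb N}(p)=p(0)$. $\mathbf{Y}^{\mathbf{X}}$ is the represented space of total continuously realisable functions; a name of $f$ is a $p\in\mathbb N^{\mathbb N}$ coding a realiser of $f$, with $p(0)$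 the index of a Turing machine using the oracle $n\mapsto p(n+1)$. In the product $\mathbf{X}\times\mathbf{Y}$, $p$ names $(x,y)$ iff $n\mapsto p(2n)$ names $x$ and $n\mapsto p(2n+1)$ names $y$. Sierpinski space $\mathbb{S}=\{\top,\bot\}$ is represented so that $0^\omega$ names $\bot$ and every other sequence names $\top$. The space $\mathcal{O}(\mathbf{X})$ of open sets is $\mathbb{S}^{\mathbf{X}}$, identifying $U$ with its characteristic function ($x\mapsto\top$ iff $x\in U$); $U$ is computably open if it is a computable point of $\mathcal O(\mathbf X)$ (i.e. has a computable name). $\mathbf{X}$ is computably discrete if the diagonal of $\mathbf X\times\mathbf X$ is computably open, i.e. equality is semidecidable. $\mathbf{X}$ is computably admissible if the map $\mathbf{X}\to\mathcal{O}(\mathcal{O}(\mathbf{X}))$, $x\mapsto\{U\in\mathcal{O}(\mathbf{X})\mid x\in U\}$, has a computable partial inverse (defined on its image). $\mathbf{X}$ is computably overt if non-emptiness of a given $U\in\mathcal{O}(\mathbf{X})$ is semidecidable, i.e. $\{U\in\mathcal O(\mathbf X)\mid U\neq\emptyset\}$ is computably open in $\mathcal{O}(\mathbf{X})$. For a transitive relation $\ll$ on $\mathbb{N}$, an ideal is a non-empty $I\subseteq\mathbb{N}$ such that $x\ll y\in I$ implies $x\in I$, and for all $x,y\in I$ there is $z\in I$ with $x\ll z$ and $y\ll z$. $\mathbf{I}(\ll)$ is the represented space of ideals, where $p$ names $I$ iff $I=\{p(k)\mid k\in\mathbb{N}\}$. A represented space is precomputably Quasi-Polish if it is computably isomorphic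 to $\mathbf{I}(\ll)$ for some computably enumerable transitive relation $\ll$ on $\mathbb N$; it is computably Quasi-Polish if it is moreover computably overt. For an equivalence relation $R$ on $\mathbb{N}$, the quotient $\mathbb{N}/R$ is the represented space of $R$-classes where a name of a class is a name of any of its elements.
   Formalization: The equivalence of (3) with the other conditions is stated only for non-empty X: the empty represented space is computably discrete and computably Quasi-Polish, but fails (1), (2), (4) and (5). *)

(* Defs.v *)
From Stdlib Require Import Arith Lia Cantor RelationClasses.
From Stdlib Require Import Classical ClassicalEpsilon FunctionalExtensionality
  PropExtensionality ProofIrrelevance.

Set Implicit Arguments.
Unset Strict Implicit.

#[local] Obligation Tactic := cbn beta.

Definition baire := nat -> nat.

(** * Oracle computation

    Partial recursive functions relative to an oracle (unary, with tuples
    coded by the Cantor pairing [Cantor.to_nat]) play the role of oracle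
    Turing machines; [index] is their Goedel numbering. Numbers outside the
    range of [index] code no program. *)

Inductive code : Set :=
| Zero | Succ | Fst | Snd
| Oracle
| Pair (f g : code)
| Comp (f g : code)
| PrimRec (f g : code)
| Mu (f : code).

(* h(a,0) = F(a), h(a,k+1) = G(a,(k,h(a,k))), for graphs F, G *)
Fixpoint primrec (F G : nat -> nat -> Prop) (a k m : nat) : Prop :=
  match k with
  | 0 => F a m
  | S j => exists u, primrec F G a j u /\ G (to_nat (a, to_nat (j, u))) m
  end.

(* [eval o c n m]: the program [c] with oracle [o] halts on input [n] with
   output [m]. [Mu f] is unbounded search for the least zero of [f (n, _)]. *)
Fixpoint eval (o : baire) (c : code) (n m : nat) : Prop :=
  match c with
  | Zero => m = 0
  | Succ => m = S n
  | Fst => m = fst (of_nat n)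
  | Snd => m = snd (of_nat n)
  | Oracle => m = o n
  | Pair f g => exists a b, eval o f n a /\ eval o g n b /\ m = to_nat (a, b)
  | Comp f g => exists k, eval o g n k /\ eval o f k m
  | PrimRec f g =>
      primrec (eval o f) (eval o g) (fst (of_nat n)) (snd (of_nat n)) m
  | Mu f =>
      eval o f (to_nat (n, m)) 0 /\
      forall j, j < m -> exists v, eval o f (to_nat (n, j)) (S v)
  end.

Fixpoint index (c : code) : nat :=
  match c with
  | Zero => to_nat (0, 0)
  | Succ => to_nat (1, 0)
  | Fst => to_nat (2, 0)
  | Snd => to_nat (3, 0)
  | Oracle => to_nat (4, 0)
  | Pair f g => to_nat (5, to_nat (index f, index g))
  | Comp f g => to_nat (6, to_nat (index f, index g))
  | PrimRec f g => to_nat (7, to_nat (index f, index g))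
  | Mu f => to_nat (8, index f)
  end.

Lemma to_nat_inj2 a b a' b' :
  to_nat (a, b) = to_nat (a', b') -> a = a' /\ b = b'.
Proof. intros H. apply to_nat_inj in H. now inversion H. Qed.

Lemma index_inj c d : index c = index d -> c = d.
Proof.
  revert d; induction c; intros d H; destruct d; cbn [index] in H;
    apply to_nat_inj2 in H; destruct H as [H0 H]; try discriminate; auto;
    try (apply to_nat_inj2 in H; destruct H); f_equal; auto.
Qed.

Lemma eval_fun o c n m m' : eval o c n m -> eval o c n m' -> m = m'.
Proof.
  revert n m m'; induction c; cbn [eval]; intros n m m'; try congruence.
  - intros (a & b & H1 & H2 & ->) (a' & b' & H1' & H2' & ->).
    now rewrite (IHc1 _ _ _ H1 H1'), (IHc2 _ _ _ H2 H2').
  - intros (k & H1 & H2) (k' & H1' & H2').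
    rewrite (IHc2 _ _ _ H1 H1') in H2. eauto.
  - generalize (fst (of_nat n)) as a; generalize (snd (of_nat n)) as k.
    intros k a; revert m m'; induction k as [|k IHk]; cbn; intros m m'.
    + eauto.
    + intros (u & H1 & H2) (u' & H1' & H2').
      rewrite (IHk _ _ H1 H1') in H2. eauto.
  - intros [H1 H2] [H1' H2'].
    destruct (lt_eq_lt_dec m m') as [[L | E] | L]; auto; exfalso.
    + destruct (H2' _ L) as [v Hv]. specialize (IHc _ _ _ H1 Hv). discriminate.
    + destruct (H2 _ L) as [v Hv]. specialize (IHc _ _ _ H1' Hv). discriminate.
Qed.

Definition agree (k : nat) (p q : baire) : Prop := forall i, i < k -> p i = q i.

Lemma agree_le k k' p q : k' <= k -> agree k p q -> agree k' p q.
Proof. intros L H i Hi; apply H; lia. Qed.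

Lemma eval_use o c n m : eval o c n m ->
  exists k, forall o', agree k o o' -> eval o' c n m.
Proof.
  revert n m; induction c; cbn [eval]; intros n m;
    try (intros ->; exists 0; reflexivity).
  - intros ->. exists (S n). intros o' H. apply H. lia.
  - intros (a & b & H1 & H2 & ->).
    destruct (IHc1 _ _ H1) as [k1 K1]. destruct (IHc2 _ _ H2) as [k2 K2].
    exists (k1 + k2). intros o' H. exists a, b.
    repeat split; [apply K1 | apply K2]; revert H; apply agree_le; lia.
  - intros (k & H1 & H2).
    destruct (IHc2 _ _ H1) as [k1 K1]. destruct (IHc1 _ _ H2) as [k2 K2].
    exists (k1 + k2). intros o' H. exists k.
    split; [apply K1 | apply K2]; revert H; apply agree_le; lia.
  - generalize (fst (of_nat n)) as a; generalize (snd (of_nat n)) as k.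
    intros k a; revert m; induction k as [|k IHk]; cbn; intros m.
    + eauto.
    + intros (u & H1 & H2).
      destruct (IHk _ H1) as [k1 K1]. destruct (IHc2 _ _ H2) as [k2 K2].
      exists (k1 + k2). intros o' H. exists u.
      split; [apply K1 | apply K2]; revert H; apply agree_le; lia.
  - intros [H1 H2]. destruct (IHc _ _ H1) as [k1 K1].
    assert (exists k, forall o', agree k o o' ->
      forall j, j < m -> exists v, eval o' c (to_nat (n, j)) (S v)) as [k2 K2].
    { clear H1 K1 k1. induction m as [|m IHm].
      - exists 0. intros; lia.
      - destruct IHm as [k1 K1]; [intros; apply H2; lia|].
        destruct (H2 m) as [v Hv]; [lia|]. destruct (IHc _ _ Hv) as [k2 K2].
        exists (k1 + k2). intros o' H j Hj.
        assert (j < m \/ j = m) as [L | ->] by lia.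
        + apply K1; auto. revert H; apply agree_le; lia.
        + exists v. apply K2. revert H; apply agree_le; lia. }
    exists (k1 + k2). intros o' H.
    split; [apply K1 | apply K2]; revert H; apply agree_le; lia.
Qed.

(** Partial maps on Baire space are given by their (single-valued) graphs. *)
Definition single_valued (F : baire -> baire -> Prop) : Prop :=
  forall p q q', F p q -> F p q' -> q = q'.

Definition continuous_on_domain (F : baire -> baire -> Prop) : Prop :=
  forall p q, F p q -> forall n, exists k,
    forall p' q', F p' q' -> agree k p p' -> agree n q q'.

(* the partial map on Baire space computed by [c] *)
Definition Phi (c : code) (p q : baire) : Prop := forall n, eval p c n (q n).

Definition computable_point (p : baire) : Prop :=
  exists c, Phi c (fun _ => 0) p.

(* [A] is the range of a partial computable function; this includes the empty
   set. *)
Definition computably_enumerable (A : nat -> Prop) : Prop :=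
  exists c, forall n, A n <-> exists m, eval (fun _ => 0) c m n.

(** * Represented spaces *)

Record repSpace : Type := RepSpace {
  pt :> Type;
  name : baire -> pt -> Prop;
  name_fun : forall p x y, name p x -> name p y -> x = y;
  name_surj : forall x, exists p, name p x }.

Definition realiser (X Y : repSpace) (F : baire -> baire -> Prop) (f : X -> Y)
  : Prop :=
  forall p x, name p x -> exists q, F p q /\ name q (f x).

Definition computable (X Y : repSpace) (f : X -> Y) : Prop :=
  exists c, realiser (Phi c) f.

Definition continuously_realisable (X Y : repSpace) (f : X -> Y) : Prop :=
  exists F, single_valued F /\ continuous_on_domain F /\ realiser F f.

Definition computably_isomorphic (X Y : repSpace) : Prop :=
  exists (f : X -> Y) (g : Y -> X),
    (forall x, g (f x) = x) /\ (forall y, f (g y) = y) /\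
    computable f /\ computable g.

Definition has_computable_name (X : repSpace) (x : X) : Prop :=
  exists p, computable_point p /\ name p x.

Definition computable_partial_inverse (X Y : repSpace) (f : X -> Y) : Prop :=
  exists c, forall q x, name q (f x) -> exists p, Phi c q p /\ name p x.

(** ** Natural numbers *)

Program Definition natSpace : repSpace :=
  @RepSpace nat (fun p n => p 0 = n) _ _.
Next Obligation. congruence. Qed.
Next Obligation. intros x. now exists (fun _ => x). Qed.

(** ** Products *)

Definition evens (p : baire) : baire := fun n => p (2 * n).
Definition odds (p : baire) : baire := fun n => p (2 * n + 1).

Definition join (p q : baire) : baire :=
  fun n => if Nat.even n then p (Nat.div2 n) else q (Nat.div2 n).

Lemma join_even p q n : join p q (2 * n) = p n.
Proof. unfold join. now rewrite Nat.even_even, Nat.div2_double. Qed.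

Lemma join_odd p q n : join p q (2 * n + 1) = q n.
Proof.
  unfold join. rewrite Nat.even_odd. now rewrite Nat.add_1_r, Nat.div2_succ_double.
Qed.

Lemma evens_join p q : evens (join p q) = p.
Proof. apply functional_extensionality; intro n; apply join_even. Qed.

Lemma odds_join p q : odds (join p q) = q.
Proof. apply functional_extensionality; intro n; apply join_odd. Qed.

Program Definition prodSpace (X Y : repSpace) : repSpace :=
  @RepSpace (X * Y)
    (fun p xy => name (evens p) (fst xy) /\ name (odds p) (snd xy)) _ _.
Next Obligation.
  intros X Y p [x y] [x' y'] [H1 H2] [H1' H2']. f_equal; eapply name_fun; eauto.
Qed.
Next Obligation.
  intros X Y [x y].
  destruct (name_surj x) as [a Ha]. destruct (name_surj y) as [b Hb].
  exists (join a b). cbn. now rewrite evens_join, odds_join.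
Qed.

(** ** Function spaces *)

Definition tail (p : baire) : baire := fun n => p (S n).

(* [p] codes the partial map computed by the program with index [p 0] from the
   oracle [tail p] and its argument *)
Definition coded_map (p q r : baire) : Prop :=
  exists c, index c = p 0 /\ Phi c (join (tail p) q) r.

Lemma coded_map_fun p : single_valued (coded_map p).
Proof.
  intros q r r' (c & E & H) (c' & E' & H').
  assert (c = c') as <- by (apply index_inj; congruence).
  apply functional_extensionality; intro n. eapply eval_fun; eauto.
Qed.

(** Every partial continuous map on Baire space is contained in a coded one. *)

Definition cId := Pair Fst Snd.
Definition cDbl :=
  Comp (PrimRec Zero (Comp Succ (Comp Succ (Comp Snd Snd)))) (Pair Zero cId).
Definition cAskL := Comp Oracle cDbl.
Definition cAskR := Comp Oracle (Comp Succ cDbl).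
Definition cPrefix := PrimRec Zero (Pair (Comp Snd Snd) (Comp cAskR (Comp Fst Snd))).
Definition cSegment := Pair Fst (Pair Snd cPrefix).
Definition cTest := Comp cAskL (Pair Zero cSegment).
Definition cValue := Comp cAskL (Pair (Comp Succ Zero) cSegment).
Definition cSearch := Comp cValue (Pair cId (Mu cTest)).

Fixpoint prefix (q : baire) (k : nat) : nat :=
  match k with 0 => 0 | S j => to_nat (prefix q j, q j) end.

Lemma prefix_agree q q' k : prefix q k = prefix q' k -> agree k q q'.
Proof.
  induction k as [|k IH]; cbn [prefix]; intros H i Hi; [lia|].
  apply to_nat_inj2 in H. destruct H as [H1 H2].
  assert (i < k \/ i = k) as [L | ->] by lia; auto. now apply IH.
Qed.

Lemma agree_prefix q q' k : agree k q q' -> prefix q k = prefix q' k.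
Proof.
  induction k as [|k IH]; cbn [prefix]; intros H; [reflexivity|].
  rewrite IH, H by (lia || (revert H; apply agree_le; lia)). reflexivity.
Qed.

Lemma eval_cId o n : eval o cId n n.
Proof.
  exists (fst (of_nat n)), (snd (of_nat n)). repeat split.
  now rewrite <- surjective_pairing, cancel_to_of.
Qed.

Lemma eval_Pair o f g n a b : eval o f n a -> eval o g n b ->
  eval o (Pair f g) n (to_nat (a, b)).
Proof. intros. cbn. eauto. Qed.

Lemma eval_Comp o f g n k m : eval o g n k -> eval o f k m -> eval o (Comp f g) n m.
Proof. intros. cbn. eauto. Qed.

Lemma eval_Fst o a b : eval o Fst (to_nat (a, b)) a.
Proof. cbn [eval]. now rewrite cancel_of_to. Qed.

Lemma eval_Snd o a b : eval o Snd (to_nat (a, b)) b.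
Proof. cbn [eval]. now rewrite cancel_of_to. Qed.

Lemma eval_cDbl o n : eval o cDbl n (2 * n).
Proof.
  eapply eval_Comp; [eapply eval_Pair; [reflexivity | apply eval_cId]|].
  cbn [eval]. rewrite cancel_of_to. cbn [fst snd].
  induction n as [|n IH]; [reflexivity|]. cbn [primrec].
  exists (2 * n). split; [exact IH|].
  change (eval o (Comp Succ (Comp Succ (Comp Snd Snd)))
            (to_nat (0, to_nat (n, 2 * n))) (2 * S n)).
  eapply eval_Comp; [eapply eval_Comp;
    [eapply eval_Comp; apply eval_Snd | reflexivity]|]. cbn [eval]. lia.
Qed.

Lemma eval_cAskL p q n : eval (join p q) cAskL n (p n).
Proof.
  eapply eval_Comp; [apply eval_cDbl|]. cbn [eval]. symmetry. apply join_even.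
Qed.

Lemma eval_cAskR p q n : eval (join p q) cAskR n (q n).
Proof.
  eapply eval_Comp; [eapply eval_Comp; [apply eval_cDbl | reflexivity]|].
  cbn [eval]. rewrite <- Nat.add_1_r. symmetry. apply join_odd.
Qed.

Lemma eval_cSegment p q n k :
  eval (join p q) cSegment (to_nat (n, k)) (to_nat (n, to_nat (k, prefix q k))).
Proof.
  apply eval_Pair; [apply eval_Fst|]. apply eval_Pair; [apply eval_Snd|].
  cbn [eval cPrefix]. rewrite cancel_of_to. cbn [fst snd].
  induction k as [|k IH]; [reflexivity|]. cbn [primrec prefix].
  exists (prefix q k). split; [exact IH|].
  apply (@eval_Pair _ (Comp Snd Snd) (Comp cAskR (Comp Fst Snd))).
  - eapply eval_Comp; apply eval_Snd.
  - eapply eval_Comp; [eapply eval_Comp; [apply eval_Snd | apply eval_Fst]|].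
    apply eval_cAskR.
Qed.

Lemma continuous_coded F : single_valued F -> continuous_on_domain F ->
  exists p, forall q r, F q r -> coded_map p q r.
Proof.
  intros _ HC.
  set (determined := fun x v =>
    let n := fst (of_nat x) in
    let k := fst (of_nat (snd (of_nat x))) in
    let w := snd (of_nat (snd (of_nat x))) in
    forall q r, F q r -> prefix q k = w -> r n = v).
  set (a := fun y : nat =>
    let x := snd (of_nat y) in
    match fst (of_nat y) with
    | 0 => if excluded_middle_informative (exists v, determined x v)
           then 0 else 1
    | _ => epsilon (inhabits 0) (determined x)
    end).
  exists (fun i => match i with 0 => index cSearch | S j => a j end).
  intros q r Hqr. exists cSearch. split; [reflexivity|]. intros n.
  change (tail _) with a.
  assert (T : forall k, eval (join a q) cTest (to_nat (n, k))
                (a (to_nat (0, to_nat (n, to_nat (k, prefix q k)))))).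
  { intros k. eapply eval_Comp; [|apply eval_cAskL].
    apply eval_Pair; [reflexivity | apply eval_cSegment]. }
  assert (V : forall k, eval (join a q) cValue (to_nat (n, k))
                (a (to_nat (1, to_nat (n, to_nat (k, prefix q k)))))).
  { intros k. eapply eval_Comp; [|apply eval_cAskL].
    apply eval_Pair; [eapply eval_Comp; reflexivity | apply eval_cSegment]. }
  set (seg := fun k => to_nat (n, to_nat (k, prefix q k))) in *.
  set (P := fun k => exists v, determined (seg k) v).
  assert (exists k, P k) as EP.
  { destruct (HC _ _ Hqr (S n)) as [k Hk]. exists k, (r n).
    unfold determined, seg. rewrite !cancel_of_to; cbn [fst snd];
      rewrite !cancel_of_to; cbn [fst snd].
    intros q' r' H' E. symmetry. apply (Hk q' r' H'); [|lia].
    apply prefix_agree. now symmetry. }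
  destruct (dec_inh_nat_subset_has_unique_least_element P
              (fun k => classic (P k)) EP) as (k & (Pk & Min) & _).
  replace (r n) with (a (to_nat (1, seg k))).
  - eapply eval_Comp; [|apply V].
    apply eval_Pair; [apply eval_cId|]. split.
    + specialize (T k). cbn [seg] in T. fold (seg k) in T.
      replace (a (to_nat (0, seg k))) with 0 in T; [exact T|].
      unfold a. rewrite cancel_of_to. cbn [fst snd].
      now destruct (excluded_middle_informative (exists v, determined (seg k) v)).
    + intros j Hj. exists 0. specialize (T j). fold (seg j) in T.
      replace (a (to_nat (0, seg j))) with 1 in T; [exact T|].
      unfold a. rewrite cancel_of_to. cbn [fst snd].
      destruct (excluded_middle_informative (exists v, determined (seg j) v))
        as [Pj|]; [|reflexivity].
      specialize (Min j Pj). lia.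
  - unfold a. rewrite cancel_of_to. cbn [fst snd].
    pose proof (epsilon_spec (inhabits 0) (determined (seg k)) Pk) as D.
    unfold determined at 1 in D. unfold seg at 1 2 3 in D.
    rewrite !cancel_of_to in D; cbn [fst snd] in D.
    rewrite !cancel_of_to in D; cbn [fst snd] in D.
    symmetry. now apply (D q r).
Qed.

Program Definition funSpace (X Y : repSpace) : repSpace :=
  @RepSpace {f : X -> Y | continuously_realisable f}
    (fun p f => realiser (coded_map p) (proj1_sig f)) _ _.
Next Obligation.
  intros X Y p [f f_c] [g g_c] Hf Hg.
  apply subset_eq_compat. apply functional_extensionality; intro z.
  destruct (name_surj z) as [q Hq].
  destruct (Hf _ _ Hq) as (r & H1 & H2). destruct (Hg _ _ Hq) as (r' & H1' & H2').
  cbn in *. rewrite <- (coded_map_fun H1 H1') in H2'. eapply name_fun; eauto.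
Qed.
Next Obligation.
  intros X Y [f (F & SV & C & HF)].
  destruct (continuous_coded SV C) as [p Hp]. exists p. intros q z Hq.
  destruct (HF _ _ Hq) as (r & H1 & H2). eauto.
Qed.

(** ** Sierpinski space and open sets *)

(* A two-element type rather than [Prop], so that an open set literally is a
   function into it; see [mem]. *)
Inductive sierpinski : Set := Top | Bot.

Definition sierp_name (p : baire) (s : sierpinski) : Prop :=
  match s with
  | Bot => p = (fun _ => 0)
  | Top => p <> (fun _ => 0)
  end.

Program Definition sierpSpace : repSpace :=
  @RepSpace sierpinski sierp_name _ _.
Next Obligation. intros p [] []; cbn; congruence. Qed.
Next Obligation.
  intros []; [|now exists (fun _ => 0)]. exists (fun _ => 1).
  intros E. discriminate (f_equal (fun p : baire => p 0) E).
Qed.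

Definition opens (X : repSpace) : repSpace := funSpace X sierpSpace.

Definition mem (X : repSpace) (x : X) (U : opens X) : Prop :=
  proj1_sig U x = Top.

Definition computably_open (X : repSpace) (A : X -> Prop) : Prop :=
  exists U : opens X, (forall x, mem x U <-> A x) /\ has_computable_name U.

Definition computably_discrete (X : repSpace) : Prop :=
  computably_open (X := prodSpace X X) (fun xy => fst xy = snd xy).

Definition computably_overt (X : repSpace) : Prop :=
  computably_open (X := opens X) (fun U => exists x, mem x U).

Lemma coded_map_continuous q :
  continuous_on_domain (fun p r => coded_map p q r).
Proof.
  intros p r (c & E & H) n.
  assert (exists k, forall p', agree k p p' ->
            forall i, i < n -> eval (join (tail p') q) c i (r i)) as [k K].
  { induction n as [|n [k1 K1]].
    - exists 0. intros; lia.
    - destruct (eval_use (H n)) as [k2 K2]. exists (S (k1 + k2)).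
      intros p' A i Hi. assert (i < n \/ i = n) as [L | ->] by lia.
      + apply K1; auto. revert A; apply agree_le; lia.
      + apply K2. intros j Hj. unfold join.
        destruct (Nat.even j); [|reflexivity]. unfold tail. apply A.
        pose proof (Nat.div2_div j). pose proof (Nat.Div0.div_le_upper_bound j 2 j).
        lia. }
  exists (S k). intros p' r' (c' & E' & H') A i Hi.
  assert (c = c') as <-.
  { apply index_inj. rewrite E, E'. apply A. lia. }
  eapply eval_fun; [|apply H'].
  apply K; [|exact Hi]. revert A; apply agree_le; lia.
Qed.

Lemma nbhds_continuous (X : repSpace) (x : X) :
  continuously_realisable (X := opens X) (Y := sierpSpace)
    (fun U => proj1_sig U x).
Proof.
  destruct (name_surj x) as [q Hq]. exists (fun p r => coded_map p q r).
  split; [|split].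
  - intros p r r' H H'. exact (coded_map_fun H H').
  - apply coded_map_continuous.
  - intros p U HU. exact (HU q x Hq).
Qed.

(* x |-> {U | x \in U}; the characteristic function of {U | x \in U} is
   evaluation at x *)
Definition nbhds (X : repSpace) (x : X) : opens (opens X) :=
  exist _ (fun U : opens X => proj1_sig U x) (nbhds_continuous x).

Definition computably_admissible (X : repSpace) : Prop :=
  computable_partial_inverse (@nbhds X).

(** ** Ideals and Quasi-Polish spaces *)

Definition ideal (ll : nat -> nat -> Prop) (I : nat -> Prop) : Prop :=
  (exists x, I x) /\
  (forall x y, ll x y -> I y -> I x) /\
  (forall x y, I x -> I y -> exists z, I z /\ ll x z /\ ll y z).

Program Definition idealSpace (ll : nat -> nat -> Prop) : repSpace :=
  @RepSpace {I : nat -> Prop | ideal ll I}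
    (fun p I => forall n, proj1_sig I n <-> exists k, p k = n) _ _.
Next Obligation.
  intros ll p [I I_id] [J J_id] HI HJ.
  apply subset_eq_compat. apply functional_extensionality; intro n.
  apply propositional_extensionality. cbn in *. now rewrite HI, HJ.
Qed.
Next Obligation.
  intros ll [I I_id]. pose proof I_id as ([n0 H0] & _ & _).
  exists (fun k => if excluded_middle_informative (I k) then k else n0).
  intros n. cbn. split.
  - intros Hn. exists n. now destruct (excluded_middle_informative (I n)).
  - intros [k <-]. now destruct (excluded_middle_informative (I k)).
Qed.

Definition ce_relation (ll : nat -> nat -> Prop) : Prop :=
  computably_enumerable (fun n => ll (fst (of_nat n)) (snd (of_nat n))).

Definition precomputably_QuasiPolish (X : repSpace) : Prop :=
  exists ll : nat -> nat -> Prop,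
    Transitive ll /\ ce_relation ll /\ computably_isomorphic X (idealSpace ll).

Definition computably_QuasiPolish (X : repSpace) : Prop :=
  precomputably_QuasiPolish X /\ computably_overt X.

(** ** Quotients of the natural numbers *)

Program Definition quotSpace (R : nat -> nat -> Prop) (HR : Equivalence R)
  : repSpace :=
  @RepSpace {C : nat -> Prop | exists n, forall m, C m <-> R n m}
    (fun p C => exists n, proj1_sig C n /\ name (r := natSpace) p n) _ _.
Next Obligation.
  intros R HR p [C [c HC]] [D [d HD]] (n & Cn & E) (n' & Dn & E').
  apply subset_eq_compat. apply functional_extensionality; intro m.
  apply propositional_extensionality. cbn in *. subst n n'.
  rewrite HC in *. rewrite HD in *. now rewrite Cn, Dn.
Qed.
Next Obligation.
  intros R HR [C [c HC]]. exists (fun _ => c), c. cbn. rewrite HC.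
  split; reflexivity.
Qed.

(** ** Total representations *)

Program Definition totalSpace (X : Type) (d : baire -> X)
  (d_surj : forall x, exists p, d p = x) : repSpace :=
  @RepSpace X (fun p x => d p = x) _ _.
Next Obligation. congruence. Qed.
Next Obligation. auto. Qed.

(* Main.v *)
Require Import Defs.
From Stdlib Require Import RelationClasses.
From Stdlib Require Import Arith Lia Cantor Classical ClassicalEpsilon
  FunctionalExtensionality.

(** Everything passes through a computable surjection [s] from the natural
    numbers onto X. Since equality of X is semidecidable, an index of a named
    point can be found by search, which makes [p |-> s (p 0)] a total
    representation and X isomorphic to the quotient of the natural numbers by
    [s n = s m]. This relation is computably enumerable and its classes are its
    ideals, so X is Quasi-Polish; running names of open sets on the points [s n]
    yields overtness, and running a neighbourhood filter on the open singletons
    yields admissibility.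

    Conversely, acceptance of [x = x] inspects only a finite part of a name of
    [x], and any point having a name that shares this part is equal to [x].
    Hence in a total representation the sequences that are eventually zero name
    all points, and in an overt space of ideals every point is the ideal
    generated by some increasing chain found by search. *)

Set Implicit Arguments.
Unset Strict Implicit.
#[local] Opaque to_nat of_nat.

(** * Projections of the Cantor pairing *)

#[local] Notation "⟨ a , b ⟩" := (to_nat (a, b)) (at level 0, a at level 99, b at level 99).
Definition pi1 (n : nat) : nat := fst (of_nat n).
Definition pi2 (n : nat) : nat := snd (of_nat n).

Lemma pi1_pair a b : pi1 ⟨a, b⟩ = a.
Proof. unfold pi1. now rewrite cancel_of_to. Qed.

Lemma pi2_pair a b : pi2 ⟨a, b⟩ = b.
Proof. unfold pi2. now rewrite cancel_of_to. Qed.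

Lemma pair_pi n : ⟨pi1 n, pi2 n⟩ = n.
Proof. unfold pi1, pi2. now rewrite <- surjective_pairing, cancel_to_of. Qed.

Ltac unpair := repeat (rewrite pi1_pair || rewrite pi2_pair).

(** * Uniformly computable families *)

(** The index [a] may carry data hidden from the program, such as the point that the oracle names;
    the program sees only [o a], and one program serves all [a]. *)
Definition ucomp A (o : A -> baire) (F : A -> nat -> nat) : Prop :=
  exists c, forall a, Phi c (o a) (F a).

(** Meant as a sequence of points of Baire space for each [a]. *)
Definition ucomp2 A (o : A -> baire) (F : A -> nat -> nat -> nat) : Prop :=
  ucomp o (fun a x => F a (pi1 x) (pi2 x)).

(** Correctness under every oracle allows such a function to be used inside any uniform family. *)
Definition recursive (f : nat -> nat) : Prop :=
  ucomp (fun p : baire => p) (fun _ => f).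

Lemma ucomp_ext A (o : A -> baire) F G :
  (forall a n, F a n = G a n) -> ucomp o F -> ucomp o G.
Proof. intros E [c H]. exists c. intros a n. rewrite <- E. apply H. Qed.

Lemma ucomp_id A (o : A -> baire) : ucomp o (fun _ n => n).
Proof. exists cId. intros a n. apply eval_cId. Qed.

Lemma ucomp_comp A (o : A -> baire) F G :
  ucomp o F -> ucomp o G -> ucomp o (fun a n => F a (G a n)).
Proof.
  intros [c H] [d K]. exists (Comp c d). intros a n.
  eapply eval_Comp; [apply K | apply H].
Qed.

Lemma ucomp_S A (o : A -> baire) F : ucomp o F -> ucomp o (fun a n => S (F a n)).
Proof. apply ucomp_comp with (F := fun _ n => S n). exists Succ; intros a n; reflexivity. Qed.

Lemma ucomp_const A (o : A -> baire) k : ucomp o (fun _ _ => k).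
Proof. induction k; [exists Zero; intros a n; reflexivity | exact (ucomp_S IHk)]. Qed.

Lemma ucomp_pi1 A (o : A -> baire) F : ucomp o F -> ucomp o (fun a n => pi1 (F a n)).
Proof. apply ucomp_comp with (F := fun _ n => pi1 n). exists Fst; intros a n; reflexivity. Qed.

Lemma ucomp_pi2 A (o : A -> baire) F : ucomp o F -> ucomp o (fun a n => pi2 (F a n)).
Proof. apply ucomp_comp with (F := fun _ n => pi2 n). exists Snd; intros a n; reflexivity. Qed.

Lemma ucomp_pair A (o : A -> baire) F G :
  ucomp o F -> ucomp o G -> ucomp o (fun a n => ⟨F a n, G a n⟩).
Proof. intros [c H] [d K]. exists (Pair c d). intros a n. apply eval_Pair; [apply H | apply K]. Qed.

Lemma ucomp_oracle A (o : A -> baire) F :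
  ucomp o F -> ucomp o (fun a n => o a (F a n)).
Proof. apply ucomp_comp with (F := o). exists Oracle; intros a n; reflexivity. Qed.

Lemma ucomp_rec A (o : A -> baire) b h k :
  ucomp o b -> ucomp o (fun a x => h a (pi1 x) (pi1 (pi2 x)) (pi2 (pi2 x))) ->
  ucomp o k ->
  ucomp o (fun a n => nat_rect (fun _ => nat) (b a n) (h a n) (k a n)).
Proof.
  intros [cb Hb] [ch Hh] [ck Hk].
  exists (Comp (PrimRec cb ch) (Pair cId ck)). intros a n.
  eapply eval_Comp; [eapply eval_Pair; [apply eval_cId | apply Hk]|].
  cbn [eval]. rewrite cancel_of_to. cbn [fst snd].
  induction (k a n) as [|j IH]; cbn; [apply Hb|].
  eexists. split; [exact IH|].
  specialize (Hh a ⟨n, ⟨j, nat_rect (fun _ => nat) (b a n) (h a n) j⟩⟩).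
  cbn beta in Hh. revert Hh. now unpair.
Qed.

Lemma ucomp2_app A (o : A -> baire) F G H :
  ucomp2 o F -> ucomp o G -> ucomp o H -> ucomp o (fun a n => F a (G a n) (H a n)).
Proof.
  intros HF HG HH.
  eapply ucomp_ext; [|exact (ucomp_comp HF (ucomp_pair HG HH))].
  intros a n; cbn. now unpair.
Qed.

Lemma ucomp_pred A (o : A -> baire) F :
  ucomp o F -> ucomp o (fun a n => pred (F a n)).
Proof.
  intros H.
  apply ucomp_ext with (fun a n => nat_rect (fun _ => nat) 0 (fun j _ => j) (F a n)).
  - intros a n. now destruct (F a n).
  - apply ucomp_rec with (b := fun _ _ => 0) (h := fun _ _ j _ => j); auto.
    + apply ucomp_const.
    + apply ucomp_pi1, ucomp_pi2, ucomp_id.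
Qed.

Lemma ucomp_add A (o : A -> baire) F G :
  ucomp o F -> ucomp o G -> ucomp o (fun a n => F a n + G a n).
Proof.
  intros HF HG.
  apply ucomp_ext with
    (fun a n => nat_rect (fun _ => nat) (F a n) (fun _ u => S u) (G a n)).
  - intros a n. induction (G a n); cbn; lia.
  - apply ucomp_rec with (h := fun _ _ _ u => S u); auto.
    apply ucomp_S, ucomp_pi2, ucomp_pi2, ucomp_id.
Qed.

Lemma ucomp_sub A (o : A -> baire) F G :
  ucomp o F -> ucomp o G -> ucomp o (fun a n => F a n - G a n).
Proof.
  intros HF HG.
  apply ucomp_ext with
    (fun a n => nat_rect (fun _ => nat) (F a n) (fun _ u => pred u) (G a n)).
  - intros a n. induction (G a n); cbn; lia.
  - apply ucomp_rec with (h := fun _ _ _ u => pred u); auto.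
    apply ucomp_pred, ucomp_pi2, ucomp_pi2, ucomp_id.
Qed.

Lemma ucomp_if A (o : A -> baire) F G T E :
  ucomp o F -> ucomp o G -> ucomp o T -> ucomp o E ->
  ucomp o (fun a n => if F a n =? G a n then T a n else E a n).
Proof.
  intros HF HG HT HE.
  (* The sum of the two truncated differences vanishes exactly in the case of equality; recursion on
     it ignores its accumulator and so acts as a zero test. *)
  apply ucomp_ext with (fun a n => nat_rect (fun _ => nat) (T a n)
    (fun _ _ => E a n) ((F a n - G a n) + (G a n - F a n))).
  - intros a n. destruct (Nat.eqb_spec (F a n) (G a n)) as [->|N].
    + now rewrite Nat.sub_diag.
    + destruct (F a n - G a n + (G a n - F a n)) eqn:Z; [lia | reflexivity].
  - apply ucomp_rec with (h := fun a n _ _ => E a n); auto.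
    + exact (ucomp_comp HE (ucomp_pi1 (ucomp_id o))).
    + apply ucomp_add; now apply ucomp_sub.
Qed.

Lemma ucomp_recursive A (o : A -> baire) f F :
  recursive f -> ucomp o F -> ucomp o (fun a n => f (F a n)).
Proof.
  intros [c H]. apply ucomp_comp with (F := fun _ => f). exists c. intros a. apply H.
Qed.

Ltac ucomp :=
  cbv beta;
  repeat first
    [ assumption
    | apply ucomp_id | apply ucomp_const
    | apply ucomp_S | apply ucomp_pi1 | apply ucomp_pi2 | apply ucomp_pair
    | apply ucomp_if | apply ucomp_pred | apply ucomp_oracle
    | match goal with
      | H : recursive ?f |- ucomp _ (fun a n => ?f _) => apply (ucomp_recursive H)
      | H : ucomp2 _ _ |- ucomp _ _ => apply (ucomp2_app H)
      | H : ucomp _ _ |- ucomp _ _ => apply (ucomp_comp H)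
      end ].

(** Acceptance is a nonzero entry, as in Sierpinski names, while [Mu] looks for zeros; hence the
    inverted test. Choosing the least witness matches what [Mu] returns. *)
Lemma ucomp_search A (o : A -> baire) F :
  ucomp2 o F -> (forall a n, exists i, F a n i <> 0) ->
  exists g, ucomp o g /\ forall a n, F a n (g a n) <> 0.
Proof.
  intros HF EX.
  assert (ucomp o (fun a x => if F a (pi1 x) (pi2 x) =? 0 then 1 else 0)) as [c Hc]
    by ucomp.
  assert (L : forall a n, exists i, F a n i <> 0 /\ forall j, j < i -> F a n j = 0).
  { intros a n.
    destruct (dec_inh_nat_subset_has_unique_least_element (fun i => F a n i <> 0)
      (fun k => classic _) (EX a n)) as (k & (Pk & Min) & _).
    exists k. split; auto. intros j Hj. apply NNPP. intros Q.
    specialize (Min j Q). lia. }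
  exists (fun a n => epsilon (inhabits 0)
    (fun i => F a n i <> 0 /\ forall j, j < i -> F a n j = 0)).
  split.
  - exists (Mu c). intros a n.
    pose proof (epsilon_spec (inhabits 0) _ (L a n)) as [E1 E2].
    set (i := epsilon _ _) in *. cbn [eval]. split.
    + specialize (Hc a ⟨n, i⟩). revert Hc. cbv beta. unpair.
      destruct (Nat.eqb_spec (F a n i) 0); tauto.
    + intros j Hj. exists 0. specialize (Hc a ⟨n, j⟩). revert Hc. cbv beta.
      unpair. now rewrite (E2 j Hj).
  - intros a n. exact (proj1 (epsilon_spec (inhabits 0) _ (L a n))).
Qed.

(** ** Oracle substitution *)

Lemma eval_PrimRec_intro o f g a k m :
  primrec (eval o f) (eval o g) a k m -> eval o (PrimRec f g) ⟨a, k⟩ m.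
Proof. cbn [eval]. now rewrite cancel_of_to. Qed.

(** By recursion on the program, each oracle call is replaced by a call of [e]. The parameter [a] of
    [e] is carried along as the first component of every input. *)
Lemma eval_subst_oracle c e : exists c', forall o o' a,
  (forall i, eval o e ⟨a, i⟩ (o' i)) ->
  forall n m, eval o' c n m -> eval o c' ⟨a, n⟩ m.
Proof.
  induction c as [ | | | | |f [f' F] g [g' G]|f [f' F] g [g' G]|f [f' F] g [g' G]|f [f' F]].
  - exists Zero. intros o o' a _ n m H. exact H.
  - exists (Comp Succ Snd). intros o o' a _ n m H.
    eapply eval_Comp; [apply eval_Snd | exact H].
  - exists (Comp Fst Snd). intros o o' a _ n m H.
    eapply eval_Comp; [apply eval_Snd | exact H].
  - exists (Comp Snd Snd). intros o o' a _ n m H.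
    eapply eval_Comp; [apply eval_Snd | exact H].
  - exists e. intros o o' a E n m ->. apply E.
  - exists (Pair f' g'). intros o o' a E n m (x & y & H1 & H2 & ->).
    apply eval_Pair; eauto.
  - exists (Comp f' (Pair Fst g')). intros o o' a E n m (k & H1 & H2).
    eapply eval_Comp; [eapply eval_Pair; [apply eval_Fst | eauto] | eauto].
  (* The input is regrouped so that [a] joins the parameter of the recursion; the step program
     restores the grouping that [g'] expects. *)
  - exists (Comp
      (PrimRec f' (Comp g' (Pair (Comp Fst Fst) (Pair (Comp Snd Fst) Snd))))
      (Pair (Pair Fst (Comp Fst Snd)) (Comp Snd Snd))).
    intros o o' a E n m H.
    eapply eval_Comp.
    { eapply eval_Pair; [eapply eval_Pair; [apply eval_Fst|]|];
        eapply eval_Comp; (apply eval_Snd || reflexivity). }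
    apply eval_PrimRec_intro. cbn [eval] in H.
    revert m H. generalize (fst (of_nat n)) as x, (snd (of_nat n)) as k.
    intros x. induction k as [|k IH]; cbn [primrec]; intros m; eauto.
    intros (u & H1 & H2). exists u. split; auto.
    eapply eval_Comp; [|apply (G _ _ _ E _ _ H2)].
    repeat eapply eval_Pair.
    + eapply eval_Comp; apply eval_Fst.
    + eapply eval_Comp; [apply eval_Fst | apply eval_Snd].
    + apply eval_Snd.
  - exists (Mu (Comp f' (Pair (Comp Fst Fst) (Pair (Comp Snd Fst) Snd)))).
    intros o o' a E n m [H1 H2].
    assert (K : forall j v, eval o' f ⟨n, j⟩ v -> eval o
      (Comp f' (Pair (Comp Fst Fst) (Pair (Comp Snd Fst) Snd))) ⟨⟨a, n⟩, j⟩ v).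
    { intros j v H. eapply eval_Comp; [|apply (F _ _ _ E _ _ H)].
      repeat eapply eval_Pair.
      + eapply eval_Comp; apply eval_Fst.
      + eapply eval_Comp; [apply eval_Fst | apply eval_Snd].
      + apply eval_Snd. }
    split; [now apply K|]. intros j Hj. destruct (H2 j Hj) as [v Hv].
    exists v. now apply K.
Qed.

(** Oracle substitution composes [c] with the program for [P]. The predicate [Q] passes what is
    known about each output on to the chosen family. *)
Lemma ucomp_Phi A (o : A -> baire) P c (Q : A -> nat -> baire -> Prop) :
  ucomp2 o P -> (forall a k, exists r, Phi c (P a k) r /\ Q a k r) ->
  exists F, ucomp2 o F /\ forall a k, Q a k (F a k).
Proof.
  intros [e He] H. destruct (eval_subst_oracle c e) as [c' Hc].
  set (G := fun a k r => Phi c (P a k) r /\ Q a k r) in H.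
  exists (fun a k => epsilon (inhabits (fun _ => 0)) (G a k)). split.
  - exists c'. intros a n. rewrite <- (pair_pi n) at 1.
    apply (Hc (o a) (P a (pi1 n))).
    + intros i. specialize (He a ⟨pi1 n, i⟩). revert He. cbv beta. now unpair.
    + apply (epsilon_spec (inhabits (fun _ => 0)) _ (H a (pi1 n))).
  - intros a k. apply (epsilon_spec (inhabits (fun _ => 0)) _ (H a k)).
Qed.

Lemma ucomp2_sw A (o : A -> baire) F k :
  ucomp2 o F -> ucomp o (fun a => F a k).
Proof. intros H. ucomp. Qed.

(** [computable_point] speaks of the zero oracle only; simulating that oracle gives a program
    correct under every oracle. *)
Lemma computable_point_recursive p : computable_point p -> recursive p.
Proof.
  intros [c H].
  destruct (@ucomp_Phi baire (fun q => q) (fun _ _ _ => 0) c (fun _ _ r => r = p))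
    as (F & HF & E).
  - unfold ucomp2. ucomp.
  - intros _ _. exists p. now split.
  - eapply ucomp_ext; [|exact (ucomp2_sw 0 HF)]. intros a n; cbn. now rewrite E.
Qed.

Lemma recursive_computable_point p : recursive p -> computable_point p.
Proof. intros [c H]. exists c. apply H. Qed.

(** * A universal machine *)

(* A state [⟨mode, ⟨v, K⟩⟩] returns the value [v] to the continuation [K] if
   [mode = 0] and runs the program with index [e] on [v] if [mode = S e].
   A continuation is [⟨tag, ⟨d, K'⟩⟩]; tag 0 means halt. *)
Definition resume (v tag d K : nat) : nat :=
  if tag =? 1 then ⟨S (pi1 d), ⟨pi2 d, ⟨2, ⟨v, K⟩⟩⟩⟩ else
  if tag =? 2 then ⟨0, ⟨⟨d, v⟩, K⟩⟩ else
  if tag =? 3 then ⟨S d, ⟨v, K⟩⟩ else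
  if tag =? 4 then
    if pi2 (pi2 d) =? 0 then ⟨0, ⟨v, K⟩⟩ else
    ⟨S (pi1 (pi1 d)), ⟨⟨pi2 (pi1 d), ⟨pi1 (pi2 d), v⟩⟩,
      ⟨4, ⟨⟨pi1 d, ⟨S (pi1 (pi2 d)), pred (pi2 (pi2 d))⟩⟩, K⟩⟩⟩⟩ else
  if tag =? 5 then
    if v =? 0 then ⟨0, ⟨pi2 (pi2 d), K⟩⟩ else
    ⟨S (pi1 d), ⟨⟨pi1 (pi2 d), S (pi2 (pi2 d))⟩,
      ⟨5, ⟨⟨pi1 d, ⟨pi1 (pi2 d), S (pi2 (pi2 d))⟩⟩, K⟩⟩⟩⟩ else
  ⟨0, ⟨v, ⟨tag, ⟨d, K⟩⟩⟩⟩.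

(** Here [tag] is a constructor tag of [index]. The continuations pushed are: 1 and 2 for the two
    halves of [Pair], 3 for [Comp], 4 for [PrimRec] with the step program, the parameter, the rounds
    done and the rounds left, and 5 for [Mu] with the current candidate. *)
Definition start (o : baire) (tag e v K : nat) : nat :=
  if tag =? 0 then ⟨0, ⟨0, K⟩⟩ else
  if tag =? 1 then ⟨0, ⟨S v, K⟩⟩ else
  if tag =? 2 then ⟨0, ⟨pi1 v, K⟩⟩ else
  if tag =? 3 then ⟨0, ⟨pi2 v, K⟩⟩ else
  if tag =? 4 then ⟨0, ⟨o v, K⟩⟩ else
  if tag =? 5 then ⟨S (pi1 e), ⟨v, ⟨1, ⟨⟨pi2 e, v⟩, K⟩⟩⟩⟩ else
  if tag =? 6 then ⟨S (pi2 e), ⟨v, ⟨3, ⟨pi1 e, K⟩⟩⟩⟩ else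
  if tag =? 7 then
    ⟨S (pi1 e), ⟨pi1 v, ⟨4, ⟨⟨⟨pi2 e, pi1 v⟩, ⟨0, pi2 v⟩⟩, K⟩⟩⟩⟩ else
  ⟨S e, ⟨⟨v, 0⟩, ⟨5, ⟨⟨e, ⟨v, 0⟩⟩, K⟩⟩⟩⟩.

Definition step (o : baire) (s : nat) : nat :=
  if pi1 s =? 0 then
    resume (pi1 (pi2 s)) (pi1 (pi2 (pi2 s))) (pi1 (pi2 (pi2 (pi2 s))))
      (pi2 (pi2 (pi2 (pi2 s))))
  else start o (pi1 (pred (pi1 s))) (pi2 (pred (pi1 s))) (pi1 (pi2 s)) (pi2 (pi2 s)).

Definition run (o : baire) (t s : nat) : nat := Nat.iter t (step o) s.

Lemma run_S o t s : run o (S t) s = run o t (step o s).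
Proof. unfold run. now rewrite Nat.iter_succ_r. Qed.

Lemma run_add o t t' s : run o (t + t') s = run o t' (run o t s).
Proof. unfold run. now rewrite Nat.add_comm, Nat.iter_add. Qed.

Lemma step_return o v tag d K :
  step o ⟨0, ⟨v, ⟨tag, ⟨d, K⟩⟩⟩⟩ = resume v tag d K.
Proof. unfold step. now unpair. Qed.

Lemma step_eval o tag e v K :
  step o ⟨S ⟨tag, e⟩, ⟨v, K⟩⟩ = start o tag e v K.
Proof. unfold step. unpair. cbn [Nat.eqb pred]. now unpair. Qed.

(** Induction on the code for all continuations at once, so that a subprogram returns to the frame
    its caller pushed. *)
Lemma run_complete o c n m : eval o c n m -> forall K,
  exists t, run o t ⟨S (index c), ⟨n, K⟩⟩ = ⟨0, ⟨m, K⟩⟩.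
Proof.
  assert (N : forall s s', (exists t, run o t (step o s) = s') ->
                exists t, run o t s = s').
  { intros s s' [t H]. exists (S t). rewrite run_S; exact H. }
  assert (Tr : forall s s' s'', (exists t, run o t s = s') ->
                (exists t, run o t s' = s'') -> exists t, run o t s = s'').
  { intros s s' s'' [t H] [t' H']. exists (t + t'). now rewrite run_add, H. }
  revert n m. induction c; intros n m H K; cbn [index];
    apply N; rewrite step_eval; unfold start; cbn [Nat.eqb]; unpair; cbn [eval] in H.
  1-5: subst m; exists 0; reflexivity.
  - destruct H as (a & b & H1 & H2 & ->).
    eapply Tr; [apply IHc1, H1|]. apply N. rewrite step_return.
    unfold resume; cbn [Nat.eqb]; unpair.
    eapply Tr; [apply IHc2, H2|]. apply N. rewrite step_return. exists 0; reflexivity.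
  - destruct H as (k & H1 & H2).
    eapply Tr; [apply IHc2, H1|]. apply N. rewrite step_return.
    unfold resume; cbn [Nat.eqb]; unpair. now apply IHc1.
  - fold (pi1 n) in H. fold (pi2 n) in H.
    set (F := fun j r => ⟨⟨index c2, pi1 n⟩, ⟨j, r⟩⟩).
    (* Of [k + r] rounds, [k] are done and [r] are left; letting [r] vary keeps the initial frame
       fixed during the induction on [k]. *)
    assert (L : forall k r v, primrec (eval o c1) (eval o c2) (pi1 n) k v ->
      exists t, run o t ⟨S (index c1), ⟨pi1 n, ⟨4, ⟨F 0 (k + r), K⟩⟩⟩⟩ =
                ⟨0, ⟨v, ⟨4, ⟨F k r, K⟩⟩⟩⟩).
    { induction k as [|k IHk]; cbn [primrec]; intros r v Hv.
      - now apply IHc1.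
      - destruct Hv as (u & H1 & H2).
        eapply Tr; [replace (S k + r) with (k + S r) by lia; apply IHk, H1|].
        apply N. rewrite step_return. unfold resume, F; cbn [Nat.eqb]; unpair.
        cbn [Nat.eqb pred]. now apply IHc2. }
    rewrite (plus_n_O (pi2 n)).
    eapply Tr; [apply L, H|]. apply N. rewrite step_return.
    unfold resume, F; cbn [Nat.eqb]; unpair. exists 0; reflexivity.
  - destruct H as [H1 H2].
    set (F := fun j => ⟨5, ⟨⟨index c, ⟨n, j⟩⟩, K⟩⟩).
    (* Each nonzero value advances the candidate by one, so the search reaches every [j] up to
       [m]. *)
    assert (L : forall j, j <= m -> exists t,
      run o t ⟨S (index c), ⟨⟨n, 0⟩, F 0⟩⟩ = ⟨S (index c), ⟨⟨n, j⟩, F j⟩⟩).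
    { induction j as [|j IHj]; intros Hj; [exists 0; reflexivity|].
      destruct (H2 j) as [v Hv]; [lia|].
      eapply Tr; [apply IHj; lia|]. eapply Tr; [apply IHc, Hv|].
      apply N. unfold F at 1. rewrite step_return.
      unfold resume; cbn [Nat.eqb]; unpair. exists 0; reflexivity. }
    eapply Tr; [apply (L m); lia|]. eapply Tr; [apply IHc, H1|].
    apply N. unfold F. rewrite step_return.
    unfold resume; cbn [Nat.eqb]; unpair. exists 0; reflexivity.
Qed.

Definition halts (o : baire) (t s v : nat) : Prop :=
  run o t s = ⟨0, ⟨v, ⟨0, ⟨0, 0⟩⟩⟩⟩.

Lemma halts_step o t e n K v : halts o t ⟨S e, ⟨n, K⟩⟩ v ->
  exists t', t = S t' /\ halts o t' (step o ⟨S e, ⟨n, K⟩⟩) v.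
Proof.
  unfold halts. destruct t as [|t]; rewrite ?run_S; [|eauto].
  intros H. apply to_nat_inj2 in H. destruct H; discriminate.
Qed.

Lemma halts_return o t u tag d K v : tag <> 0 ->
  halts o t ⟨0, ⟨u, ⟨tag, ⟨d, K⟩⟩⟩⟩ v ->
  exists t', t = S t' /\ halts o t' (resume u tag d K) v.
Proof.
  unfold halts. destruct t as [|t]; rewrite ?run_S, ?step_return; [|eauto].
  intros N H. do 3 (apply to_nat_inj2 in H; destruct H as [? H]). tauto.
Qed.

(** A halting run must at some moment hand a value back to [K]; cutting it there shows that the
    value is an output of [c]. *)
Lemma run_sound o c : forall t n K v, halts o t ⟨S (index c), ⟨n, K⟩⟩ v ->
  exists m t', t' < t /\ eval o c n m /\ halts o t' ⟨0, ⟨m, K⟩⟩ v.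
Proof.
  induction c; intros t n K v H; cbn [index] in H;
    apply halts_step in H; destruct H as (t1 & -> & H);
    rewrite step_eval in H; unfold start in H; cbn [Nat.eqb] in H;
    repeat (rewrite pi1_pair in H || rewrite pi2_pair in H).
  1-5: eexists _, t1; repeat split; [lia | exact H].
  - apply IHc1 in H. destruct H as (a & t2 & L2 & E1 & H).
    apply halts_return in H; [|discriminate]. destruct H as (t3 & -> & H).
    unfold resume in H; cbn [Nat.eqb] in H. rewrite pi1_pair, pi2_pair in H.
    apply IHc2 in H. destruct H as (b & t4 & L4 & E2 & H).
    apply halts_return in H; [|discriminate]. destruct H as (t5 & -> & H).
    exists ⟨a, b⟩, t5. repeat split; [lia | now apply eval_Pair | exact H].
  - apply IHc2 in H. destruct H as (a & t2 & L2 & E1 & H).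
    apply halts_return in H; [|discriminate]. destruct H as (t3 & -> & H).
    unfold resume in H; cbn [Nat.eqb] in H.
    apply IHc1 in H. destruct H as (b & t4 & L4 & E2 & H).
    exists b, t4. repeat split; [lia | eapply eval_Comp; eauto | exact H].
  - apply IHc1 in H. destruct H as (a & t2 & L2 & E1 & H).
    cbn [eval]. fold (pi1 n) (pi2 n).
    change (primrec (eval o c1) (eval o c2) (pi1 n) 0 a) in E1.
    (* Loop invariant: [j] rounds have produced [a], and [r] rounds remain. *)
    enough (L : forall r j a t2, t2 < S t1 ->
      primrec (eval o c1) (eval o c2) (pi1 n) j a ->
      halts o t2 ⟨0, ⟨a, ⟨4, ⟨⟨⟨index c2, pi1 n⟩, ⟨j, r⟩⟩, K⟩⟩⟩⟩ v ->
      exists m t', t' < S t1 /\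
        primrec (eval o c1) (eval o c2) (pi1 n) (j + r) m /\
        halts o t' ⟨0, ⟨m, K⟩⟩ v).
    { apply (L (pi2 n) 0 a t2); [lia | exact E1 | exact H]. }
    clear a t2 L2 E1 H.
    induction r as [|r IH]; intros j a t2 L2 E1 H.
    + apply halts_return in H; [|discriminate]. destruct H as (t3 & -> & H).
      unfold resume in H; cbn [Nat.eqb] in H. rewrite !pi2_pair in H.
      cbn [Nat.eqb] in H. rewrite Nat.add_0_r.
      exists a, t3. repeat split; [lia | exact E1 | exact H].
    + apply halts_return in H; [|discriminate]. destruct H as (t3 & -> & H).
      unfold resume in H; cbn [Nat.eqb] in H.
      repeat (rewrite pi1_pair in H || rewrite pi2_pair in H).
      cbn [Nat.eqb pred] in H.
      apply IHc2 in H. destruct H as (b & t4 & L4 & E2 & H).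
      rewrite Nat.add_succ_r. apply (IH (S j) b t4); [lia | | exact H].
      cbn [primrec]. eauto.
  (* The number of candidates tested is not known in advance, so the induction is on the remaining
     time, which the bound on [t'] controls. *)
  - enough (L : forall t i, t < S t1 ->
      (forall j, j < i -> exists v, eval o c ⟨n, j⟩ (S v)) ->
      halts o t ⟨S (index c), ⟨⟨n, i⟩, ⟨5, ⟨⟨index c, ⟨n, i⟩⟩, K⟩⟩⟩⟩ v ->
      exists m t', t' < S t1 /\ eval o (Mu c) n m /\ halts o t' ⟨0, ⟨m, K⟩⟩ v).
    { apply (L t1 0); [lia | intros; lia | exact H]. }
    clear H. induction t as [t IH] using lt_wf_ind. intros i L E H.
    apply IHc in H. destruct H as (b & t2 & L2 & E2 & H).
    apply halts_return in H; [|discriminate]. destruct H as (t3 & -> & H).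
    unfold resume in H; cbn [Nat.eqb] in H.
    repeat (rewrite pi1_pair in H || rewrite pi2_pair in H).
    destruct b as [|b]; cbn [Nat.eqb] in H.
    + exists i, t3. repeat split; [lia | exact E2 | exact E | exact H].
    + apply (IH t3) in H; [exact H | lia | lia |].
      intros j Hj. assert (j < i \/ j = i) as [Lj | ->] by lia; eauto.
Qed.

(* [S m] if the program with index [e] outputs [m] on [n] after at most [t]
   machine steps, and 0 otherwise *)
Definition clocked (o : baire) (e n t : nat) : nat :=
  let s := run o t ⟨S e, ⟨n, ⟨0, ⟨0, 0⟩⟩⟩⟩ in
  if pi1 s =? 0 then
    if pi2 (pi2 s) =? ⟨0, ⟨0, 0⟩⟩ then S (pi1 (pi2 s)) else 0
  else 0.

Lemma clocked_complete o c n m : eval o c n m ->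
  exists t, clocked o (index c) n t = S m.
Proof.
  intros H. destruct (run_complete H ⟨0, ⟨0, 0⟩⟩) as [t Ht]. exists t.
  unfold clocked. rewrite Ht. unpair. now rewrite !Nat.eqb_refl.
Qed.

Lemma clocked_sound o c n m t : clocked o (index c) n t = S m -> eval o c n m.
Proof.
  unfold clocked. set (s := run _ _ _).
  destruct (Nat.eqb_spec (pi1 s) 0) as [E1|]; [|discriminate].
  destruct (Nat.eqb_spec (pi2 (pi2 s)) ⟨0, ⟨0, 0⟩⟩) as [E2|]; [|discriminate].
  intros [= E3].
  assert (H : halts o t ⟨S (index c), ⟨n, ⟨0, ⟨0, 0⟩⟩⟩⟩ m).
  { unfold halts. fold s. now rewrite <- (pair_pi s), <- (pair_pi (pi2 s)), E1, E2, E3. }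
  apply run_sound in H. destruct H as (m' & t' & _ & E & H).
  replace m with m'; [exact E|].
  (* A value returned to the halting continuation is a fixed point of [step], so the final state
     still carries [m']. *)
  assert (F : forall j, run o j ⟨0, ⟨m', ⟨0, ⟨0, 0⟩⟩⟩⟩ = ⟨0, ⟨m', ⟨0, ⟨0, 0⟩⟩⟩⟩).
  { induction j as [|j IH]; [reflexivity|]. now rewrite run_S, step_return. }
  unfold halts in H. rewrite F in H.
  do 2 (apply to_nat_inj2 in H; destruct H as [? H]). assumption.
Qed.

(** Since the index is an input, one program simulates all of them. *)
Lemma ucomp_clocked : ucomp (fun p : baire => p)
  (fun p x => clocked p (pi1 x) (pi1 (pi2 x)) (pi2 (pi2 x))).
Proof.
  assert (H : ucomp (fun p : baire => p) (fun p x =>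
    run p (pi2 (pi2 x)) ⟨S (pi1 x), ⟨pi1 (pi2 x), ⟨0, ⟨0, 0⟩⟩⟩⟩)).
  { unfold run, Nat.iter.
    apply ucomp_rec with (h := fun p _ _ s => step p s); unfold step, resume, start; ucomp. }
  unfold clocked. ucomp.
Qed.

(** * Joins and the evaluation of coded maps *)

Lemma recursive_even : recursive (fun n => if Nat.even n then 0 else 1).
Proof.
  apply ucomp_ext with (fun _ n => nat_rect (fun _ => nat) 0
    (fun _ u => if u =? 0 then 1 else 0) n).
  - intros _ n. induction n as [|n IH]; [reflexivity|].
    rewrite Nat.even_succ, <- Nat.negb_even. cbn [nat_rect]. rewrite IH.
    now destruct (Nat.even n).
  - apply ucomp_rec with (h := fun _ _ _ u => if u =? 0 then 1 else 0); ucomp.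
Qed.

Lemma recursive_div2 : recursive Nat.div2.
Proof.
  pose proof recursive_even as E.
  apply ucomp_ext with (fun _ n => nat_rect (fun _ => nat) 0
    (fun j u => if (if Nat.even j then 0 else 1) =? 0 then u else S u) n).
  - intros _ n. induction n as [|n IH]; [reflexivity|]. cbn [nat_rect]. rewrite IH.
    destruct (Nat.even n) eqn:P.
    + apply Nat.even_spec in P. destruct P as [k ->].
      now rewrite Nat.div2_succ_double, Nat.div2_double.
    + assert (Nat.odd n = true) as Q by now rewrite <- Nat.negb_even, P.
      apply Nat.odd_spec in Q. destruct Q as [k ->].
      replace (S (2 * k + 1)) with (2 * S k) by lia.
      rewrite Nat.div2_double, Nat.add_1_r. cbn [Nat.eqb].
      now rewrite Nat.div2_succ_double.
  - apply ucomp_rec with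
      (h := fun _ _ j u => if (if Nat.even j then 0 else 1) =? 0 then u else S u); ucomp.
    apply (ucomp_recursive E). ucomp.
Qed.

Lemma ucomp_join A (o : A -> baire) P Q :
  ucomp2 o P -> ucomp2 o Q -> ucomp2 o (fun a k => join (P a k) (Q a k)).
Proof.
  intros HP HQ. pose proof recursive_div2.
  apply ucomp_ext with (fun a x =>
    if (if Nat.even (pi2 x) then 0 else 1) =? 0 then P a (pi1 x) (Nat.div2 (pi2 x))
    else Q a (pi1 x) (Nat.div2 (pi2 x))).
  - intros a x. unfold join. now destruct (Nat.even (pi2 x)).
  - ucomp. apply (ucomp_recursive recursive_even). ucomp.
Qed.

(** A name presents its program only through the number [P a k 0], so the universal machine runs it
    with growing time bounds; this search ends because the coded map is defined at [Q a k]. *)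
Lemma ucomp_coded A (o : A -> baire) P Q (S : A -> nat -> baire -> Prop) :
  ucomp2 o P -> ucomp2 o Q ->
  (forall a k, exists r, coded_map (P a k) (Q a k) r /\ S a k r) ->
  exists F, ucomp2 o F /\ forall a k, S a k (F a k).
Proof.
  intros HP HQ H. destruct ucomp_clocked as [c Hc].
  assert (HT : ucomp2 o (fun a k => tail (P a k))).
  { unfold ucomp2, tail. ucomp. }
  destruct (ucomp_Phi (c := c) (Q := fun a k r => r = fun x =>
      clocked (join (tail (P a k)) (Q a k)) (pi1 x) (pi1 (pi2 x)) (pi2 (pi2 x)))
    (ucomp_join HT HQ)) as (C & HC & EC).
  { intros a k. eexists. split; [apply (Hc (join (tail (P a k)) (Q a k)))|reflexivity]. }
  set (G := fun a x t => C a (pi1 x) ⟨P a (pi1 x) 0, ⟨pi2 x, t⟩⟩).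
  assert (HG : ucomp2 o G) by (unfold ucomp2, G; ucomp).
  destruct (ucomp_search HG) as (g & Hg & Eg).
  { intros a x. destruct (H a (pi1 x)) as (r & (d & Ed & Hd) & _).
    destruct (clocked_complete (Hd (pi2 x))) as [t Ht]. exists t.
    unfold G. rewrite EC. unpair. rewrite <- Ed, Ht. discriminate. }
  exists (fun a k i => pred (G a ⟨k, i⟩ (g a ⟨k, i⟩))). split.
  - unfold ucomp2. ucomp.
  - intros a k. destruct (H a k) as (r & (d & Ed & Hd) & HS).
    assert (r = fun i => pred (G a ⟨k, i⟩ (g a ⟨k, i⟩))) as <-; [|exact HS].
    apply functional_extensionality. intros i. specialize (Eg a ⟨k, i⟩).
    revert Eg. unfold G. unpair. generalize (g a ⟨k, i⟩) as t. intros t.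
    rewrite EC. unpair. rewrite <- Ed. intros N.
    destruct (clocked _ _ _ _) as [|m] eqn:E in *; [easy|].
    apply clocked_sound in E. cbn [pred]. exact (eval_fun (Hd i) E).
Qed.

(** Removes the dummy oracle from families that were built without real input. *)
Lemma ucomp_at_zero F : ucomp (fun p : baire => p) F -> recursive (F (fun _ => 0)).
Proof.
  intros [c H].
  destruct (@ucomp_Phi baire (fun q => q) (fun _ _ _ => 0) c
    (fun _ _ r => r = F (fun _ => 0))) as (G & HG & E).
  - unfold ucomp2. ucomp.
  - intros _ _. eexists. split; [apply (H (fun _ => 0)) | reflexivity].
  - eapply ucomp_ext; [|exact (ucomp2_sw 0 HG)]. intros a n; cbn. now rewrite E.
Qed.

Definition recursive2 (f : nat -> nat -> nat) : Prop :=
  recursive (fun x => f (pi1 x) (pi2 x)).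

Lemma recursive2_ucomp2 A (o : A -> baire) f :
  recursive2 f -> ucomp2 o (fun _ => f).
Proof. intros H. apply (ucomp_recursive H), ucomp_id. Qed.

Lemma ucomp_evens A (o : A -> baire) : ucomp2 o (fun a _ => evens (o a)).
Proof. unfold ucomp2, evens. cbn [Nat.mul]. ucomp. repeat apply ucomp_add; ucomp. Qed.

Lemma ucomp_odds A (o : A -> baire) : ucomp2 o (fun a _ => odds (o a)).
Proof. unfold ucomp2, odds. cbn [Nat.mul]. ucomp. repeat apply ucomp_add; ucomp. Qed.

(** * Represented spaces *)

(** The index type for uniform families on [X]: programs read [nm], specifications mention [val],
    and results may depend on the name. *)
Record named (X : repSpace) : Type := Named {
  nm : baire;
  val : X;
  nmP : name nm val }.

Lemma computable_intro (X Y : repSpace) (f : X -> Y) F :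
  ucomp (@nm X) F -> (forall a, name (F a) (f (val a))) -> computable f.
Proof.
  intros [c H] E. exists c. intros p x Hp. exists (F (Named Hp)).
  split; [apply (H (Named Hp)) | apply (E (Named Hp))].
Qed.

Lemma computable_apply (X Y : repSpace) (f : X -> Y) A (o : A -> baire) P x :
  computable f -> ucomp2 o P -> (forall a k, name (P a k) (x a k)) ->
  exists F, ucomp2 o F /\ forall a k, name (F a k) (f (x a k)).
Proof.
  intros [c H] HP N. apply (@ucomp_Phi A o P c (fun a k r => name r (f (x a k)))); auto.
Qed.

Lemma not_zero_ex (r : baire) : r <> (fun _ => 0) <-> exists i, r i <> 0.
Proof.
  split.
  - intros N. apply NNPP. intros Q. apply N. apply functional_extensionality.
    intros i. apply NNPP. intros Ri. apply Q. now exists i.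
  - intros [i Hi] ->. now apply Hi.
Qed.

Lemma sierp_name_mem (X : repSpace) (x : X) (U : opens X) r :
  name (r := sierpSpace) r (proj1_sig U x) -> (mem x U <-> exists i, r i <> 0).
Proof.
  rewrite <- not_zero_ex. unfold mem. destruct (proj1_sig U x); cbn.
  - tauto.
  - intros ->. split; [discriminate | congruence].
Qed.

Lemma open_apply (X : repSpace) A (o : A -> baire) P Q (U : A -> nat -> opens X) x :
  ucomp2 o P -> ucomp2 o Q -> (forall a k, name (P a k) (U a k)) ->
  (forall a k, name (Q a k) (x a k)) ->
  exists F, ucomp2 o F /\
    forall a k, mem (x a k) (U a k) <-> exists i, F a k i <> 0.
Proof.
  intros HP HQ NP NQ.
  apply (ucomp_coded (S := fun a k r => mem (x a k) (U a k) <-> exists i, r i <> 0)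
    HP HQ).
  intros a k. destruct (NP a k (Q a k) (x a k) (NQ a k)) as (r & H1 & H2).
  exists r. split; [exact H1 | exact (sierp_name_mem H2)].
Qed.

Lemma semidecide_open (X : repSpace) (B : X -> Prop) A (o : A -> baire) P x :
  computably_open B -> ucomp2 o P -> (forall a k, name (P a k) (x a k)) ->
  exists F, ucomp2 o F /\ forall a k, B (x a k) <-> exists i, F a k i <> 0.
Proof.
  intros (U & HU & p & Hp & Np) HP N. apply computable_point_recursive in Hp.
  destruct (open_apply (o := o) (P := fun _ _ => p) (Q := P)
    (U := fun _ _ => U) (x := x))
    with (2 := HP) as (F & HF & E); auto.
  - unfold ucomp2. ucomp.
  - exists F. split; [exact HF|]. intros a k. now rewrite <- HU, E.
Qed.

(** Each output uses finitely many oracle entries. This is needed because points of [opens X] must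
    be continuously realisable. *)
Lemma coded_map_continuous_arg p : continuous_on_domain (coded_map p).
Proof.
  intros q r (c & E & H) n.
  assert (exists k, forall q', agree k q q' ->
            forall i, i < n -> eval (join (tail p) q') c i (r i)) as [k K].
  { induction n as [|n [k1 K1]].
    - exists 0. intros; lia.
    - destruct (eval_use (H n)) as [k2 K2]. exists (k1 + k2).
      intros q' A i Hi. assert (i < n \/ i = n) as [L | ->] by lia.
      + apply K1; auto. revert A; apply agree_le; lia.
      + apply K2. intros j Hj. unfold join.
        destruct (Nat.even j); [reflexivity|]. apply A.
        pose proof (Nat.div2_decr j j). lia. }
  exists k. intros q' r' (c' & E' & H') A i Hi.
  assert (c = c') as <- by (apply index_inj; congruence).
  eapply eval_fun; [apply K; eassumption | apply H'].
Qed.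

(** Currying: all names [u n] share one program index at entry 0 and store [n] in the remaining
    entries, from which the program recovers it. *)
Lemma open_family (X : repSpace) (A : nat -> X -> Prop) F :
  ucomp2 (@nm X) F ->
  (forall a n, A n (val a) <-> exists i, F a n i <> 0) ->
  exists (U : nat -> opens X) (u : nat -> baire), recursive2 u /\
    forall n, name (u n) (U n) /\ forall x, mem x (U n) <-> A n x.
Proof.
  intros [c Hc] HA.
  (* This is the oracle that [coded_map (u n)] presents, the tail of [u n] being constantly [n]. *)
  set (o := fun b : named X * nat => join (fun _ => snd b) (nm (fst b))).
  destruct (ucomp_Phi (o := o) (P := fun b _ => odds (o b)) (c := c)
    (Q := fun b _ r => r = fun x => F (fst b) (pi1 x) (pi2 x))) as (G & HG & EG).
  { apply ucomp_odds. }
  { intros b _. eexists. split; [|reflexivity]. unfold o. rewrite odds_join.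
    apply Hc. }
  assert (ucomp o (fun b i => G b 0 ⟨o b 0, i⟩)) as [d Hd] by ucomp.
  set (u := fun n i : nat => match i with 0 => index d | S _ => n end).
  assert (R : forall n q x, name q x -> exists r, coded_map (u n) q r /\
                (A n x <-> exists i, r i <> 0)).
  { intros n q x N. exists (F (Named N) n). split; [|apply (HA (Named N) n)].
    exists d. split; [reflexivity|]. intros i.
    specialize (Hd (Named N, n) i). cbv beta in Hd.
    rewrite EG in Hd. revert Hd. unpair. now unfold o. }
  set (chi := fun n x => if excluded_middle_informative (A n x) then Top else Bot).
  assert (RC : forall n, realiser (X := X) (Y := sierpSpace) (coded_map (u n)) (chi n)).
  { intros n q x N. destruct (R n q x N) as (r & H1 & H2). exists r.
    split; [exact H1|]. unfold chi. cbn [name sierpSpace sierp_name].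
    destruct (excluded_middle_informative (A n x)) as [a|a]; cbn.
    - now rewrite not_zero_ex, <- H2.
    - rewrite H2, <- not_zero_ex in a. now apply NNPP. }
  assert (C : forall n, continuously_realisable (X := X) (Y := sierpSpace) (chi n)).
  { intros n. exists (coded_map (u n)).
    split; [apply coded_map_fun | split; [apply coded_map_continuous_arg | apply RC]]. }
  exists (fun n => exist _ (chi n) (C n)), u. split.
  - apply ucomp_ext with (fun _ x => if pi2 x =? 0 then index d else pi1 x); [|ucomp].
    intros _ x. unfold u. now destruct (pi2 x).
  - intros n. split; [apply RC|]. intros x. unfold mem, chi. cbn.
    now destruct (excluded_middle_informative (A n x)).
Qed.

Lemma computably_open_intro (X : repSpace) (B : X -> Prop) F :
  ucomp2 (@nm X) F -> (forall a, B (val a) <-> exists k i, F a k i <> 0) ->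
  computably_open B.
Proof.
  intros HF HB.
  destruct (@open_family X (fun _ => B) (fun a _ x => F a (pi1 x) (pi2 x)))
    as (U & u & Hu & HU).
  - unfold ucomp2. ucomp.
  - intros a _. rewrite HB. split.
    + intros (k & i & H). exists ⟨k, i⟩. now unpair.
    + intros [x H]. eauto.
  - exists (U 0). split; [apply HU|]. exists (u 0). split; [|apply HU].
    apply recursive_computable_point. apply (@recursive2_ucomp2 baire (fun p => p)) in Hu.
    exact (ucomp2_sw 0 Hu).
Qed.

Lemma semidecide_eq (X : repSpace) A (o : A -> baire) P Q (x y : A -> nat -> X) :
  computably_discrete X -> ucomp2 o P -> ucomp2 o Q ->
  (forall a k, name (P a k) (x a k)) -> (forall a k, name (Q a k) (y a k)) ->
  exists F, ucomp2 o F /\ forall a k, x a k = y a k <-> exists i, F a k i <> 0.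
Proof.
  intros D HP HQ NP NQ.
  apply (semidecide_open (x := fun a k => (x a k, y a k) : prodSpace X X) D
    (ucomp_join HP HQ)).
  intros a k. cbn. rewrite evens_join, odds_join. auto.
Qed.

(* Semideciding [h y = h y] reads only finitely much of a name of [y]. *)
Lemma discrete_locally_constant (X Y : repSpace) (h : Y -> X) p y :
  computably_discrete X -> computable h -> name p y ->
  exists K, forall p' y', name p' y' -> agree K p p' -> h y' = h y.
Proof.
  intros D Hh N.
  set (o := fun b : named Y * named Y => join (nm (fst b)) (nm (snd b))).
  destruct (computable_apply (x := fun b _ => val (fst b)) Hh (ucomp_evens o))
    as (P & HP & NP).
  { intros b _. unfold o. rewrite evens_join. apply nmP. }
  destruct (computable_apply (x := fun b _ => val (snd b)) Hh (ucomp_odds o))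
    as (Q & HQ & NQ).
  { intros b _. unfold o. rewrite odds_join. apply nmP. }
  destruct (semidecide_eq D HP HQ NP NQ) as (F & [c Hc] & E).
  (* The pair of [p] with itself is accepted at some entry [i], which depends on [K] entries of the
     joined oracle; changing the second name beyond them preserves acceptance. *)
  destruct (proj1 (E (Named N, Named N) 0) eq_refl) as [i Hi].
  destruct (eval_use (Hc (Named N, Named N) ⟨0, i⟩)) as [K HK].
  exists K. intros p' y' N' A. symmetry.
  apply (E (Named N, Named N') 0). exists i.
  specialize (Hc (Named N, Named N') ⟨0, i⟩). cbv beta in Hc.
  replace (F (Named N, Named N') 0 i) with (F (Named N, Named N) 0 i); [exact Hi|].
  assert (AJ : agree K (o (Named N, Named N)) (o (Named N, Named N'))).
  { intros j Hj. unfold o, join; cbn. destruct (Nat.even j); [reflexivity|].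
    apply A. pose proof (Nat.div2_decr j j). lia. }
  pose proof (eval_fun (HK _ AJ) Hc) as V. revert V. unpair. auto.
Qed.

(** * Computable images of the natural numbers *)

Definition enumerable (X : repSpace) (s : nat -> X) (S : nat -> baire) : Prop :=
  (forall x, exists n, s n = x) /\ recursive2 S /\ forall n, name (S n) (s n).

Lemma computable_enumerable (X : repSpace) (s : natSpace -> X) :
  computable s -> (forall x, exists n, s n = x) -> exists S, enumerable s S.
Proof.
  intros Hs Surj.
  destruct (computable_apply (o := fun p : baire => p) (P := fun _ n _ => n)
    (x := fun _ n => n : natSpace) Hs) as (F & HF & N).
  - unfold ucomp2. ucomp.
  - reflexivity.
  - exists (F (fun _ => 0)). split; [exact Surj|]. split; [|intros n; apply N].
    exact (ucomp_at_zero HF).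
Qed.

Section Enumerable.
Context (X : repSpace) (D : computably_discrete X).
Context (s : nat -> X) (S : nat -> baire) (HS : enumerable s S).

(** The search runs over a candidate [n] together with an accepting position of the test for
    [s n = val a]. Two names of one point may yield different indices. *)
Lemma index_search : exists h : named X -> nat,
  ucomp (@nm X) (fun a _ => h a) /\ forall a, s (h a) = val a.
Proof.
  destruct HS as (Surj & RS & N). pose proof (recursive2_ucomp2 (@nm X) RS).
  destruct (@semidecide_eq X _ (@nm X) (fun _ => S) (fun a _ => nm a)
    (fun _ => s) (fun a _ => val a)) as (F & HF & E); auto.
  - unfold ucomp2. ucomp.
  - intros a _. apply nmP.
  - destruct (@ucomp_search _ (@nm X) (fun a _ z => F a (pi1 z) (pi2 z)))
      as (g & Hg & Eg).
    + unfold ucomp2. ucomp.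
    + intros a _. destruct (Surj (val a)) as [n Hn].
      apply E in Hn. destruct Hn as [i Hi]. exists ⟨n, i⟩. now unpair.
    + exists (fun a => pi1 (g a 0)). split; [ucomp|].
      intros a. apply E. eauto.
Qed.

Lemma kernel_semidecidable : exists T, recursive2 T /\
  forall n m, s n = s m <-> exists i, T ⟨n, m⟩ i <> 0.
Proof.
  destruct HS as (_ & RS & N).
  pose proof (recursive2_ucomp2 (fun p : baire => p) RS).
  destruct (@semidecide_eq X _ (fun p : baire => p) (fun _ k => S (pi1 k))
    (fun _ k => S (pi2 k)) (fun _ k => s (pi1 k)) (fun _ k => s (pi2 k)))
    as (F & HF & E); auto; try (unfold ucomp2; ucomp).
  exists (F (fun _ => 0)). split; [exact (ucomp_at_zero HF)|].
  intros n m. rewrite <- E. now unpair.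
Qed.

Lemma enumerable_total : exists (d : baire -> X) (d_surj : forall x, exists p, d p = x),
  computable (X := totalSpace d_surj) (Y := X) (fun x => x) /\
  computable (X := X) (Y := totalSpace d_surj) (fun x => x).
Proof.
  destruct HS as (Surj & RS & N). destruct index_search as (h & Hh & Eh).
  assert (d_surj : forall x, exists p : baire, s (p 0) = x).
  { intros x. destruct (Surj x) as [n Hn]. now exists (fun _ => n). }
  exists (fun p => s (p 0)), d_surj. split.
  - pose proof (recursive2_ucomp2 (@nm (totalSpace d_surj)) RS).
    apply computable_intro with (fun a i => S (nm a 0) i); [ucomp|].
    intros a. rewrite <- (nmP a). apply N.
  - apply computable_intro with (fun a _ => h a); [exact Hh | exact Eh].
Qed.

Definition kernel n m : Prop := s n = s m.

Lemma kernel_equivalence : Equivalence kernel.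
Proof. unfold kernel. split; red; congruence. Qed.

Let Q := quotSpace kernel_equivalence.

Lemma quot_name_eq (C : Q) n m : proj1_sig C n -> (proj1_sig C m <-> s n = s m).
Proof.
  destruct C as [C [k Hk]]; cbn. rewrite !Hk. unfold kernel. intros ->. reflexivity.
Qed.

Lemma quot_eq (C C' : Q) n : proj1_sig C n -> proj1_sig C' n -> C = C'.
Proof.
  intros H H'. apply (name_fun (p := fun _ => n)); exists n; now split.
Qed.

Lemma iso_quotient : computably_isomorphic X Q.
Proof.
  destruct HS as (Surj & RS & N). destruct index_search as (h & Hh & Eh).
  assert (cls : forall x, exists n, forall m, s m = x <-> kernel n m).
  { intros x. destruct (Surj x) as [n Hn]. exists n. intros m. unfold kernel.
    rewrite Hn. split; congruence. }
  set (f := fun x => exist _ (fun m => s m = x) (cls x) : Q).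
  assert (ne : forall C : Q, exists n, proj1_sig C n).
  { intros [C [n Hn]]. exists n. apply Hn. reflexivity. }
  set (g := fun C : Q => s (epsilon (inhabits 0) (proj1_sig C))).
  (* [s] is constant on each class, so the choice in [g] is immaterial and a realiser may use the
     representative in the given name. *)
  assert (Eg : forall (C : Q) n, proj1_sig C n -> g C = s n).
  { intros C n Hn. symmetry. apply (quot_name_eq _ Hn).
    apply epsilon_spec, ne. }
  exists f, g. split; [|split; [|split]].
  - intros x. destruct (Surj x) as [n Hn]. rewrite <- Hn. now apply Eg.
  - intros C. destruct (ne C) as [n Hn]. apply (quot_eq (n := n)); [|exact Hn].
    symmetry. now apply Eg.
  - apply computable_intro with (fun a _ => h a); [exact Hh|].
    intros a. exists (h a). split; [apply Eh | reflexivity].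
  - pose proof (recursive2_ucomp2 (@nm Q) RS).
    apply computable_intro with (fun a i => S (nm a 0) i); [ucomp|].
    intros a. destruct (nmP a) as (n & Hn & E). cbn in E. subst n.
    rewrite (Eg _ _ Hn). apply N.
Qed.

Lemma quotient_discrete : computably_discrete Q.
Proof.
  destruct kernel_semidecidable as (T & RT & ET).
  pose proof (recursive2_ucomp2 (@nm (prodSpace Q Q)) RT).
  (* Entries 0 and 1 of a name of a pair are the initial entries of its two halves, hence
     representatives of the two classes. *)
  apply computably_open_intro with (fun a _ i => T ⟨nm a 0, nm a 1⟩ i).
  - unfold ucomp2. ucomp.
  - intros a. destruct (nmP a) as [(n & Hn & En) (m & Hm & Em)].
    destruct (val a) as [C C']. cbn in *.
    change (nm a 0 = n) in En. change (nm a 1 = m) in Em. rewrite En, Em.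
    transitivity (s n = s m).
    + rewrite <- (quot_name_eq m Hn). split; [now intros -> |].
      intros H'. now apply (quot_eq (n := m)).
    + rewrite ET. split; [now exists 0 | now intros [_ ?]].
Qed.

(** For each [n], the class of [n] forms an open singleton with name [u n], uniformly in [n].
    Feeding these to a name of the neighbourhood filter of [C] semidecides membership in [C], and
    any member found names [C]. *)
Lemma quotient_admissible : computably_admissible Q.
Proof.
  destruct kernel_semidecidable as (T & RT & ET).
  pose proof (recursive2_ucomp2 (@nm Q) RT).
  destruct (@open_family Q (fun n C => proj1_sig C n) (fun a n i => T ⟨nm a 0, n⟩ i))
    as (U & u & Ru & HU).
  { unfold ucomp2. ucomp. }
  { intros a n. destruct (nmP a) as (m & Hm & <-). cbn in Hm |- *.
    rewrite (quot_name_eq n Hm). apply ET. }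
  set (A := {qC : baire * Q | name (fst qC) (nbhds (snd qC))}).
  set (o := fun a : A => fst (proj1_sig a)).
  pose proof (recursive2_ucomp2 o Ru).
  destruct (@open_apply (opens Q) A o (fun a _ => o a) (fun _ => u)
    (fun a _ => nbhds (snd (proj1_sig a))) (fun _ => U)) as (F & HF & EF); auto.
  { unfold ucomp2. ucomp. }
  { intros a _. exact (proj2_sig a). }
  { intros a k. apply HU. }
  assert (EM : forall a n, proj1_sig (snd (proj1_sig a)) n <-> exists i, F a n i <> 0).
  { intros a n. rewrite <- EF. symmetry. exact (proj2 (HU n) _). }
  destruct (@ucomp_search A o (fun a _ z => F a (pi1 z) (pi2 z))) as (g & [c Hc] & Eg).
  { unfold ucomp2. ucomp. }
  { intros a _. destruct (proj2_sig (snd (proj1_sig a))) as [n Hn].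
    destruct (proj1 (EM a n)) as [i Hi].
    - apply Hn. reflexivity.
    - exists ⟨n, i⟩. now unpair. }
  assert (ucomp o (fun a _ => pi1 (g a 0))) as [c' Hc'].
  { assert (ucomp o g) by now exists c. ucomp. }
  exists c'. intros q C Hq. set (a := exist _ (q, C) Hq : A).
  exists (fun _ => pi1 (g a 0)). split; [apply (Hc' a)|].
  exists (pi1 (g a 0)). split; [|reflexivity].
  apply (EM a). eauto.
Qed.

(* For an equivalence relation, the ideals are exactly the classes. *)
Lemma enumerable_precomputably_QuasiPolish : precomputably_QuasiPolish X.
Proof.
  destruct HS as (Surj & RS & N). destruct index_search as (h & Hh & Eh).
  destruct kernel_semidecidable as (T & RT & ET).
  exists kernel. split; [|split].
  - exact (@Equivalence_Transitive _ _ kernel_equivalence).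
  - pose proof (recursive2_ucomp2 (fun p : baire => p) RT).
    (* A failed test outputs a reflexive pair, which is always in the kernel. *)
    assert (ucomp (fun p : baire => p) (fun _ x =>
      if T (pi1 x) (pi2 x) =? 0 then ⟨pi1 (pi1 x), pi1 (pi1 x)⟩ else pi1 x))
      as [c Hc] by ucomp.
    exists c. intros x. fold (pi1 x) (pi2 x). split.
    + intros E. apply ET in E. rewrite pair_pi in E. destruct E as [i Hi].
      exists ⟨x, i⟩. specialize (Hc (fun _ => 0) ⟨x, i⟩). revert Hc. cbv beta. unpair.
      now destruct (Nat.eqb_spec (T x i) 0).
    + intros [m Hm]. rewrite <- (eval_fun (Hc (fun _ => 0) m) Hm).
      destruct (Nat.eqb_spec (T (pi1 m) (pi2 m)) 0) as [|Z]; unpair; [reflexivity|].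
      apply ET. rewrite pair_pi. eauto.
  - set (Y := idealSpace kernel).
    assert (cls : forall x, ideal kernel (fun m => s m = x)).
    { unfold kernel. intros x. destruct (Surj x) as [n Hn]. split; [now exists n|].
      split; [congruence|]. intros a b Ha Hb. exists n. repeat split; congruence. }
    assert (mem_ideal : forall (I : Y) n m, proj1_sig I n -> (proj1_sig I m <-> s n = s m)).
    { intros [I HI] n m Hn. pose proof HI as (_ & I2 & I3). cbn in *. split.
      - intros Hm. destruct (I3 n m Hn Hm) as (z & _ & H1 & H2). unfold kernel in *.
        congruence.
      - intros E. apply (I2 m n); [now symmetry | exact Hn]. }
    set (f := fun x => exist _ _ (cls x) : Y).
    set (g := fun I : Y => s (epsilon (inhabits 0) (proj1_sig I))).
    assert (Eg : forall (I : Y) n, proj1_sig I n -> g I = s n).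
    { intros I n Hn. symmetry. apply (mem_ideal I _ _ Hn). apply epsilon_spec. eauto. }
    exists f, g. split; [|split; [|split]].
    + intros x. destruct (Surj x) as [n Hn]. rewrite <- Hn. now apply Eg.
    + intros I. destruct (proj2_sig I) as [[n Hn] _].
      destruct (name_surj I) as [p Hp]. apply (name_fun (p := p)); [|exact Hp].
      intros m. cbn. rewrite (Eg _ _ Hn), <- (Hp m), (mem_ideal I n m Hn). split; congruence.
    + pose proof (recursive2_ucomp2 (@nm X) RT).
      apply computable_intro with
        (fun a x => if T ⟨h a, pi1 x⟩ (pi2 x) =? 0 then h a else pi1 x).
      * ucomp; exact Hh.
      * intros a n. cbn. rewrite <- (Eh a). split.
        -- intros E. symmetry in E. apply ET in E. destruct E as [i Hi].
           exists ⟨n, i⟩. unpair. now destruct (Nat.eqb_spec (T ⟨h a, n⟩ i) 0).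
        -- intros [k <-]. destruct (Nat.eqb_spec (T ⟨h a, pi1 k⟩ (pi2 k)) 0);
             [reflexivity|]. symmetry. apply ET. eauto.
    + pose proof (recursive2_ucomp2 (@nm Y) RS).
      apply computable_intro with (fun a i => S (nm a 0) i); [ucomp|].
      intros a. rewrite (Eg (val a) (nm a 0)); [apply N|].
      apply (nmP a). now exists 0.
Qed.

Lemma enumerable_overt : computably_overt X.
Proof.
  destruct HS as (Surj & RS & N).
  pose proof (recursive2_ucomp2 (@nm (opens X)) RS).
  destruct (@open_apply X _ (@nm (opens X)) (fun a _ => nm a) (fun _ => S)
    (fun a _ => val a) (fun _ => s)) as (F & HF & E); auto.
  - unfold ucomp2. ucomp.
  - intros a _. apply nmP.
  - apply computably_open_intro with F; [exact HF|]. intros a. split.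
    + intros [x Hx]. destruct (Surj x) as [n <-]. exists n. now apply E.
    + intros [n Hn]. exists (s n). now apply E.
Qed.

End Enumerable.

(** * From quotients back to surjections *)

Lemma quotient_image (X : repSpace) R (HR : Equivalence R) :
  computably_isomorphic X (quotSpace HR) ->
  exists s : natSpace -> X, computable s /\ forall x, exists n, s n = x.
Proof.
  intros (f & g & gf & fg & _ & c & Hc).
  set (cls := fun n => exist (fun C => exists n, forall m, C m <-> R n m) (R n)
    (ex_intro _ n (fun m => iff_refl _)) : quotSpace HR).
  assert (cls_in : forall n, proj1_sig (cls n) n) by (intros n; cbn; reflexivity).
  exists (fun n => g (cls n)). split.
  (* A name of [n] already names its class, so the realiser of [g] serves unchanged. *)
  - exists c. intros p n E. apply Hc. exists n. split; [apply cls_in | exact E].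
  - intros x. destruct (f x) as [C [n Hn]] eqn:E. exists n.
    rewrite <- (gf x), E. f_equal. apply (name_fun (p := fun _ => n)); exists n.
    + split; [apply cls_in | reflexivity].
    + split; [apply Hn; reflexivity | reflexivity].
Qed.

(** * Total representations *)

(* [n] read as the finite sequence it codes, continued by zeros; this uses
   [of_nat 0 = (0, 0)]. *)
Definition decode (n i : nat) : nat := pi1 (Nat.iter i pi2 n).

Lemma decode_dense p k : exists n, agree k p (decode n).
Proof.
  revert p. induction k as [|k IH]; intros p.
  - exists 0. intros i Hi. lia.
  - destruct (IH (tail p)) as [n Hn]. exists ⟨p 0, n⟩. intros [|i] Hi.
    + unfold decode. cbn. now unpair.
    + unfold decode. rewrite Nat.iter_succ_r, pi2_pair. apply (Hn i). lia.
Qed.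

Lemma total_image (X : repSpace) (d : baire -> X) (d_surj : forall x, exists p, d p = x) :
  computably_discrete X ->
  computable (X := totalSpace d_surj) (Y := X) (fun x => x) ->
  exists s : natSpace -> X, computable s /\ forall x, exists n, s n = x.
Proof.
  intros D Hd. exists (fun n => d (decode n)). split.
  - assert (ucomp2 (@nm natSpace) (fun a _ => decode (nm a 0))).
    { unfold ucomp2, decode, Nat.iter. apply ucomp_pi1.
      apply ucomp_rec with (h := fun _ _ _ u => pi2 u); ucomp. }
    destruct (computable_apply (X := totalSpace d_surj) (Y := X)
      (x := fun a _ => d (decode (nm a 0))) Hd H)
      as (F & HF & N); [reflexivity|].
    apply computable_intro with (fun a => F a 0); [exact (ucomp2_sw 0 HF)|].
    intros a. rewrite <- (nmP a). apply N.
  - intros x. destruct (d_surj x) as [p Hp].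
    destruct (@discrete_locally_constant X (totalSpace d_surj) _ p x D Hd Hp) as [K HK].
    (* Totality makes [decode n] a name, and it shares with [p] the entries that determine [x]. *)
    destruct (decode_dense p K) as [n Hn]. exists n.
    now apply (HK (decode n) (d (decode n))).
Qed.

(** * Overt spaces of ideals *)

Lemma recursive_range (B : nat -> Prop) W : recursive2 W ->
  (forall n, B n <-> exists i, W n i <> 0) -> (exists n, B n) ->
  exists e, recursive e /\ (forall k, B (e k)) /\ forall n, B n -> exists k, e k = n.
Proof.
  intros HW EW [n0 H0]. pose proof (recursive2_ucomp2 (fun p : baire => p) HW).
  (* The member [n0] is a constant of the program and fills in for failed tests. *)
  exists (fun k => if W (pi1 k) (pi2 k) =? 0 then n0 else pi1 k).
  split; [|split].
  - unfold recursive. ucomp.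
  - intros k. destruct (Nat.eqb_spec (W (pi1 k) (pi2 k)) 0); [exact H0|].
    apply EW. eauto.
  - intros n Hn. apply EW in Hn. destruct Hn as [i Hi]. exists ⟨n, i⟩. unpair.
    now destruct (Nat.eqb_spec (W n i) 0).
Qed.

(** Clocking makes the enumeration total; the shift by one leaves 0 for stages without output. *)
Lemma computably_enumerable_clocked A : computably_enumerable A ->
  exists E, recursive E /\ forall n, A n <-> exists z, E z = S n.
Proof.
  intros [c Hc]. destruct ucomp_clocked as [cl Hcl].
  assert (R : recursive (fun x => clocked (fun _ => 0) (pi1 x) (pi1 (pi2 x)) (pi2 (pi2 x)))).
  { apply (@ucomp_at_zero (fun p x => clocked p (pi1 x) (pi1 (pi2 x)) (pi2 (pi2 x)))).
    now exists cl. }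
  exists (fun z => clocked (fun _ => 0) (index c) (pi1 z) (pi2 z)). split.
  - apply ucomp_ext with (fun _ z =>
      (fun x => clocked (fun _ => 0) (pi1 x) (pi1 (pi2 x)) (pi2 (pi2 x)))
        ⟨index c, ⟨pi1 z, pi2 z⟩⟩).
    + intros _ z. cbv beta. now unpair.
    + apply (ucomp_recursive R). ucomp.
  - intros n. rewrite Hc. split.
    + intros [m Hm]. destruct (clocked_complete Hm) as [t Ht].
      exists ⟨m, t⟩. now unpair.
    + intros [z Hz]. exists (pi1 z). exact (clocked_sound Hz).
Qed.

Lemma chain_ideal (ll : nat -> nat -> Prop) (a : nat -> nat) :
  Transitive ll -> (forall j, ll (a j) (a (S j))) ->
  ideal ll (fun y => exists j, ll y (a j)).
Proof.
  intros Tr Ha.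
  assert (up : forall y i j, ll y (a i) -> ll y (a (j + i))).
  { intros y i j H. induction j as [|j IH]; [exact H|]. exact (Tr _ _ _ IH (Ha _)). }
  split; [|split].
  (* [ll] need not be reflexive, so [a 0] belongs by way of [a 1]. *)
  - exists (a 0), 1. apply Ha.
  - intros x y L [j Hj]. exists j. exact (Tr _ _ _ L Hj).
  - intros x y [i Hi] [j Hj]. exists (a (i + j)).
    split; [exists (S (i + j)); apply Ha|].
    split; [rewrite Nat.add_comm|]; now apply up.
Qed.

(** Iterated directedness; it provides the start of a chain lying above a finite part of a name. *)
Lemma ideal_upper_bound ll I (p : baire) k : ideal ll I -> Transitive ll ->
  (forall i, I (p i)) -> exists n, I n /\ forall i, i < k -> ll (p i) n.
Proof.
  intros ([n0 H0] & _ & dir) Tr Hp. induction k as [|k (n & Hn & L)].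
  - exists n0. split; [exact H0 | lia].
  - destruct (dir n (p k) Hn (Hp k)) as (z & Hz & L1 & L2). exists z.
    split; [exact Hz|]. intros i Hi.
    assert (i < k \/ i = k) as [Li | ->] by lia; [|exact L2].
    exact (Tr _ _ _ (L i Li) L1).
Qed.

(* Overtness makes the set of [n] lying in some ideal semidecidable; from such
   an [n] an increasing chain can be searched for, and it generates an ideal
   containing [n]. Since points are isolated, every point arises this way. *)
Lemma QuasiPolish_image (X : repSpace) :
  computably_discrete X -> inhabited X -> computably_QuasiPolish X ->
  exists s : natSpace -> X, computable s /\ forall x, exists n, s n = x.
Proof.
  intros D [x0] [(ll & Tr & CE & f & g & gf & fg & Hf & Hg) OV].
  set (Y := idealSpace ll) in *.
  destruct (computable_apply (o := @nm X) (P := fun a _ => nm a)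
    (x := fun a _ => val a) Hf) as (N & HN & EN).
  { unfold ucomp2. ucomp. }
  { intros a _. apply nmP. }
  (* A name of [f x] lists the ideal, so membership of [n] in it is open in [x], uniformly in
     [n]. *)
  destruct (@open_family X (fun n x => proj1_sig (f x) n)
    (fun a n i => if N a 0 i =? n then 1 else 0)) as (U & u & Hu & HU).
  { unfold ucomp2. ucomp. }
  { intros a n. rewrite (EN a 0 n). split; intros [i Hi]; exists i.
    - now rewrite Hi, Nat.eqb_refl.
    - now destruct (Nat.eqb_spec (N a 0 i) n). }
  destruct (@semidecide_open _ _ baire (fun p => p) (fun _ => u) (fun _ => U) OV)
    as (W & HW & EW).
  { now apply recursive2_ucomp2. }
  { intros _ n. apply HU. }
  specialize (EW (fun _ => 0)).
  destruct (@recursive_range (fun n => exists x, proj1_sig (f x) n) (W (fun _ => 0)))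
    as (e & He & Ee & Ee').
  { exact (ucomp_at_zero HW). }
  { intros n. rewrite <- EW. split; intros [x Hx]; exists x; now apply HU. }
  { destruct (proj2_sig (f x0)) as [[n Hn] _]. eauto. }
  destruct (computably_enumerable_clocked CE) as (L & HL & EL).
  assert (EL' : forall a b, ll a b <-> exists z, L z = S ⟨a, b⟩).
  { intros a b. rewrite <- EL. fold (pi1 ⟨a, b⟩) (pi2 ⟨a, b⟩). now unpair. }
  clear EL.
  (* Directedness applied to [e k] and itself gives some [b] above it in the same ideal, and [b] is
     again a value of [e]; [z] codes its index and a stage of [L] witnessing the relation. *)
  destruct (@ucomp_search baire (fun p => p)
    (fun _ k z => if L (pi2 z) =? S ⟨e k, e (pi1 z)⟩ then 1 else 0))
    as (nx & Hnx & Enx).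
  { unfold ucomp2. ucomp. }
  { intros _ k. destruct (Ee k) as [x Hx].
    destruct (proj2_sig (f x)) as (_ & _ & dir).
    destruct (dir _ _ Hx Hx) as (b & Hb & Lab & _).
    destruct (Ee' b) as [k' <-]; [eauto|]. apply EL' in Lab.
    destruct Lab as [z Hz]. exists ⟨k', z⟩. unpair. now rewrite Hz, Nat.eqb_refl. }
  set (next := fun k => pi1 (nx (fun _ => 0) k)).
  assert (Hnext : recursive next) by (apply (ucomp_at_zero (F := fun p k => pi1 (nx p k))); ucomp).
  assert (Lnext : forall k, ll (e k) (e (next k))).
  { intros k. apply EL'. specialize (Enx (fun _ => 0) k). cbv beta in Enx.
    exists (pi2 (nx (fun _ => 0) k)).
    destruct (Nat.eqb_spec (L (pi2 (nx (fun _ => 0) k)))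
      (S ⟨e k, e (pi1 (nx (fun _ => 0) k))⟩)); [assumption | easy]. }
  clearbody next. clear Enx Hnx.
  set (chain := fun k j => e (Nat.iter j next k)).
  assert (Hchain : recursive2 chain).
  { unfold recursive2, recursive, chain, Nat.iter. apply (ucomp_recursive He).
    apply ucomp_rec with (h := fun _ _ _ v => next v); ucomp. }
  assert (Lchain : forall k j, ll (chain k j) (chain k (S j))).
  { intros k j. apply Lnext. }
  set (J := fun k => exist _ _ (chain_ideal Tr (Lchain k)) : Y).
  (* Entry [i] lists the left member of the pair enumerated at stage [pi1 i] if its right member is
     [chain k (pi2 i)]; otherwise it repeats [chain k 0], which lies below [chain k 1]. *)
  set (q := fun k i => if L (pi1 i) =? S ⟨pi1 (pred (L (pi1 i))), chain k (pi2 i)⟩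
                       then pi1 (pred (L (pi1 i))) else chain k 0).
  assert (Nq : forall k, name (q k) (J k)).
  { intros k y. cbn. split.
    - intros [j Hj]. apply EL' in Hj. destruct Hj as [z Hz]. exists ⟨z, j⟩.
      unfold q. unpair. rewrite Hz. cbn [pred]. unpair. now rewrite Nat.eqb_refl.
    - intros [i <-]. unfold q.
      destruct (Nat.eqb_spec (L (pi1 i)) (S ⟨pi1 (pred (L (pi1 i))), chain k (pi2 i)⟩))
        as [E|_].
      + exists (pi2 i). apply EL'. eauto.
      + exists 1. apply Lchain. }
  exists (fun k => g (J k)). split.
  - pose proof (recursive2_ucomp2 (@nm natSpace) Hchain).
    destruct (computable_apply (o := @nm natSpace) (P := fun a _ => q (nm a 0))
      (x := fun a _ => J (nm a 0)) Hg) as (F & HF & EF); [|intros; apply Nq|].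
    { unfold ucomp2, q. ucomp. }
    apply computable_intro with (fun a => F a 0); [exact (ucomp2_sw 0 HF)|].
    intros a. rewrite <- (nmP a). apply EF.
  - intros x. destruct (name_surj (f x)) as [p Hp].
    destruct (discrete_locally_constant D Hg Hp) as [K HK].
    destruct (ideal_upper_bound (p := p) K (proj2_sig (f x)) Tr) as (n & Hn & Ln).
    { intros i. apply Hp. eauto. }
    destruct (Ee' n) as [k <-]; [eauto|]. exists k.
    rewrite <- (gf x).
    (* The first [K] entries of [p] lie below [chain k 0], hence in [J k], so prefixing them to
       [q k] gives another name of [J k]; it agrees with [p] far enough to force
       [g (J k) = g (f x)]. *)
    apply (HK (fun i => if i <? K then p i else q k (i - K))).
    + intros y. rewrite (Nq k y). split.
      * intros [i Hi]. exists (i + K).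
        destruct (Nat.ltb_spec (i + K) K); [lia|]. now rewrite Nat.add_sub.
      * intros [i <-]. destruct (Nat.ltb_spec i K) as [Li|_]; [|eauto].
        apply (Nq k). exists 0. now apply Ln.
    + intros i Hi. destruct (Nat.ltb_spec i K); [reflexivity | lia].
Qed.

Theorem theorem14 (X : repSpace) (X_discrete : computably_discrete X) :
  let admits_total_representation :=
    exists (d : baire -> X) (d_surj : forall x, exists p, d p = x),
      computable (X := totalSpace d_surj) (Y := X) (fun x => x) /\
      computable (X := X) (Y := totalSpace d_surj) (fun x => x) in
  let computable_image_of_nat :=
    exists s : natSpace -> X,
      computable s /\ (forall x, exists n, s n = x) in
  let discrete_quotient :=
    exists (R : nat -> nat -> Prop) (HR : Equivalence R),
      computably_discrete (quotSpace HR) /\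
      computably_isomorphic X (quotSpace HR) in
  let admissible_quotient :=
    exists (R : nat -> nat -> Prop) (HR : Equivalence R),
      computably_admissible (quotSpace HR) /\
      computably_isomorphic X (quotSpace HR) in
  (admits_total_representation <-> computable_image_of_nat) /\
  (* the empty space is computably Quasi-Polish, but fails the other four *)
  (inhabited X -> (admits_total_representation <-> computably_QuasiPolish X)) /\
  (admits_total_representation <-> discrete_quotient) /\
  (admits_total_representation <-> admissible_quotient).
Proof.
  intros total image discrete admissible.
  assert (TI : total -> image).
  { intros (d & d_surj & H & _). exact (total_image X_discrete H). }
  assert (IE : image -> exists s S, @enumerable X s S).
  { intros (s & Hs & Surj). exists s. exact (computable_enumerable Hs Surj). }
  assert (IT : image -> total).
  { intros H. destruct (IE H) as (s & S & E). exact (enumerable_total X_discrete E). }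
  split; [now split|]. split; [|split].
  - intros inh. split; intros H.
    + destruct (IE (TI H)) as (s & S & E). split.
      * exact (enumerable_precomputably_QuasiPolish X_discrete E).
      * exact (enumerable_overt E).
    + apply IT. exact (QuasiPolish_image X_discrete inh H).
  - split; intros H.
    + destruct (IE (TI H)) as (s & S & E). exists (kernel s), (kernel_equivalence s).
      split; [exact (quotient_discrete X_discrete E) | exact (iso_quotient X_discrete E)].
    + apply IT. destruct H as (R & HR & _ & H). exact (quotient_image H).
  - split; intros H.
    + destruct (IE (TI H)) as (s & S & E). exists (kernel s), (kernel_equivalence s).
      split; [exact (quotient_admissible X_discrete E) | exact (iso_quotient X_discrete E)].
    + apply IT. destruct H as (R & HR & _ & H). exact (quotient_image H).
Qed.
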